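(* Let $p$ be a prime and $X=\mathbb{A}^1_{\mathbb{F}_p}$. There exists an extension $$0\to\mathcal{O}_{X/\mathbb{Q}_p}\to\mathcal{M}\to\mathcal{O}_{X/\mathbb{Q}_p}\to 0$$ of convergent isocrystals over $\mathbb{A}^1_{\mathbb{F}_p}$ such that $\mathcal{M}$ is not a subquotient of any $F$-invariant convergent isocrystal over $\mathbb{A}^1_{\mathbb{F}_p}$.
   Context: Convergent isocrystals are $\mathbb{Q}_p$-linear, i.e. objects of the category $\mathbf{Isoc}(X/\mathbb{Q}_p)$ of convergent isocrystals over $X$, and $\mathcal{O}_{X/\mathbb{Q}_p}$ is the unit object of this category. $F$ denotes the absolute Frobenius of $X$; pullback along $F$ defines an autoequivalence $F^*$ of $\mathbf{Isoc}(X/\mathbb{Q}_p)$. A convergent isocrystal $\mathcal{N}$ is *$F$-invariant* if $F^*\mathcal{N}\simeq\mathcal{N}$. *)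

(* Defs.v *)
From HB Require Import structures.
From mathcomp Require Import all_boot all_order all_algebra.

Set Implicit Arguments.
Unset Strict Implicit.
Unset Printing Implicit Defensive.

Import GRing.Theory.
Local Open Scope ring_scope.

(* Convergent isocrystals on X = Spec B over Q_p, as crystals on Ogus's
   convergent site, for B a commutative ring of characteristic p.  As in the
   usual presentation of a crystal by modules, only affine formal schemes
   T = Spf A are used as test objects, and everything is written with rings,
   so arrows between formal schemes are reversed.

   The category is an ordinary (large) one: its objects are indexed by all
   enlargements in the universe of MathComp's ring types. *)

Section PadicRings.

Variables (p : nat) (A : comNzRingType).

Definition pdvd (k : nat) (x : A) : Prop := exists y, x = p%:R ^+ k * y.

Definition padic_separated : Prop := forall x, (forall k, pdvd k x) -> x = 0.

Definition padic_complete : Prop := forall u : nat -> A,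
  (forall k, pdvd k (u k.+1 - u k)) -> exists l, forall k, pdvd k (l - u k).

(* Flatness over Z_p. *)
Definition p_torsion_free : Prop := forall x : A, p%:R * x = 0 -> x = 0.

Definition is_subring (S : A -> Prop) : Prop :=
  [/\ S 1, forall x y, S x -> S y -> S (x - y)
         & forall x y, S x -> S y -> S (x * y)].

(* A / pA is generated as a ring by finitely many elements.  For A p-adically
   complete and separated, this says that Spf A is of finite type over
   Spf Z_p. *)
Definition finite_type_mod_p : Prop :=
  exists (n : nat) (a : 'I_n -> A), forall S : A -> Prop,
    is_subring S -> (forall i, S (a i)) -> (forall x, pdvd 1 x -> S x) ->
    forall x, S x.

End PadicRings.

(* An enlargement (T, z) of X = Spec B: T = Spf A is a p-adic formal scheme,
   flat and of finite type over Z_p, and z : T_0 -> X is a morphism, T_0 being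
   the reduced closed subscheme of T defined by p.
     ering    = A,
     eringQ   = A[1/p], with its localization map eloc,
     ered     = A / sqrt(pA), the ring of T_0, with its projection epi,
     estr     = the ring morphism B -> A / sqrt(pA) dual to z.
   (A[1/p], eloc) and (A / sqrt(pA), epi) are determined by A up to a unique
   isomorphism.  The empty formal scheme (A = 0) is left out: a module over
   the zero ring carries no information. *)
Record enlargement (p : nat) (B : comNzRingType) := Enlargement {
  ering : comNzRingType;
  ering_separated : padic_separated p ering;
  ering_complete : padic_complete p ering;
  ering_flat : p_torsion_free p ering;
  ering_finite_type : finite_type_mod_p p ering;
  eringQ : comNzRingType;
  eloc : {rmorphism ering -> eringQ};
  eloc_inj : injective eloc;
  eloc_p : exists i : eringQ, p%:R * i = 1;
  eloc_frac : forall x : eringQ, exists k a, p%:R ^+ k * x = eloc a;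
  ered : comNzRingType;
  epi : {rmorphism ering -> ered};
  epi_surj : forall y, exists x, epi x = y;
  epi_ker : forall x, epi x = 0 <-> exists n, pdvd p 1 (x ^+ n);
  estr : {rmorphism B -> ered}
}.

(* A ring morphism A -> A' (a morphism of formal schemes T' -> T) with the maps
   it induces on A[1/p] and on A / sqrt(pA), the latter being compatible with
   the structure maps to X.  A ring morphism is automatically p-adically
   continuous and Z_p-linear. *)
Record ehom (p : nat) (B : comNzRingType) (T T' : enlargement p B) := EHom {
  ehom_fun : {rmorphism ering T -> ering T'};
  ehomQ : {rmorphism eringQ T -> eringQ T'};
  ehomQ_loc : forall a, ehomQ (eloc T a) = eloc T' (ehom_fun a);
  ehom_red : {rmorphism ered T -> ered T'};
  ehom_red_pi : forall a, ehom_red (epi T a) = epi T' (ehom_fun a);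
  ehom_red_str : forall b, ehom_red (estr T b) = estr T' b
}.

Definition finitely_generated (R : nzRingType) (M : lmodType R) : Prop :=
  exists (n : nat) (e : 'I_n -> M),
    forall x, exists a : 'I_n -> R, x = \sum_(i < n) a i *: e i.

(* A phi-semilinear map t : M -> M' induces an isomorphism R' (x)_R M -> M',
   expressed by the universal property of the base change. *)
Definition is_base_change (R R' : nzRingType) (phi : {rmorphism R -> R'})
    (M : lmodType R) (M' : lmodType R')
    (t : {linear M -> M' | phi \; *:%R}) : Prop :=
  forall (N : lmodType R') (h : {linear M -> N | phi \; *:%R}),
    exists k : {linear M' -> N}, (forall x, k (t x) = h x) /\
      forall k' : {linear M' -> N}, (forall x, k' (t x) = h x) -> k' =1 k.

(* The coherent Q (x) O_T-modules E_T are finitely generated modules over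
   A[1/p] (which is noetherian).  The transition isomorphisms f^* E_T -> E_T'
   are given through the corresponding semilinear maps E_T -> E_T'.  In [itr_id]
   and [itr_comp] the morphisms are compared through [ehom_fun], which determines
   the other two components. *)
Record isocrystal (p : nat) (B : comNzRingType) := Isocrystal {
  iev : forall T : enlargement p B, lmodType (eringQ T);
  iev_fg : forall T, finitely_generated (iev T);
  itr : forall (T T' : enlargement p B) (f : ehom T T'),
    {linear iev T -> iev T' | ehomQ f \; *:%R};
  itr_id : forall T (f : ehom T T), ehom_fun f =1 id -> itr f =1 id;
  itr_comp : forall T T' T'' (f : ehom T T') (g : ehom T' T'') (h : ehom T T''),
    ehom_fun h =1 ehom_fun g \o ehom_fun f -> itr h =1 itr g \o itr f;
  itr_base_change : forall T T' (f : ehom T T'), is_base_change (itr f)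
}.

Record isoc_hom (p : nat) (B : comNzRingType) (E E' : isocrystal p B) :=
  IsocHom {
    ihom : forall T, {linear iev E T -> iev E' T};
    ihom_nat : forall T T' (f : ehom T T') x,
      ihom T' (itr E f x) = itr E' f (ihom T x)
  }.

Definition isoc_iso (p : nat) (B : comNzRingType) (E E' : isocrystal p B) :
    Prop :=
  exists (u : isoc_hom E E') (v : isoc_hom E' E),
    (forall T, cancel (ihom u T) (ihom v T)) /\
    (forall T, cancel (ihom v T) (ihom u T)).

(* The unit object O_{X/Q_p}, with value A[1/p] at (Spf A, z). *)
Section Unit.

Variables (p : nat) (B : comNzRingType).

Definition unit_ev (T : enlargement p B) : lmodType (eringQ T) := (eringQ T)^o.

Lemma unit_fg (T : enlargement p B) : finitely_generated (unit_ev T).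
Proof.
exists 1, (fun=> (1 : (eringQ T)^o)) => x; exists (fun=> x).
by rewrite big_ord1 /GRing.scale /= mulr1.
Qed.

Definition unit_fun (T T' : enlargement p B) (f : ehom T T') :
  unit_ev T -> unit_ev T' := ehomQ f.

Section Transition.

Variables (T T' : enlargement p B) (f : ehom T T').

Fact unit_fun_zmod : zmod_morphism (unit_fun f).
Proof. by move=> x y; rewrite /unit_fun; exact: (rmorphB (ehomQ f)). Qed.

Fact unit_fun_scalable : scalable_for (ehomQ f \; *:%R) (unit_fun f).
Proof. by move=> a x; exact: (rmorphM (ehomQ f)). Qed.

HB.instance Definition _ :=
  GRing.isZmodMorphism.Build (unit_ev T) (unit_ev T') (unit_fun f)
    unit_fun_zmod.
HB.instance Definition _ :=
  GRing.isScalable.Build (eringQ T) (unit_ev T) (unit_ev T')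
    (ehomQ f \; *:%R) (unit_fun f) unit_fun_scalable.

Definition unit_tr : {linear unit_ev T -> unit_ev T' | ehomQ f \; *:%R} :=
  unit_fun f.

Lemma unit_base_change : is_base_change unit_tr.
Proof.
move=> N h.
pose k (y : unit_ev T') : N := (y : eringQ T') *: h (1 : eringQ T).
have k_zmod : zmod_morphism k by move=> x y; rewrite /k scalerBl.
have k_scal : scalable k by move=> a x; rewrite /k scalerA.
pose kZ := GRing.isZmodMorphism.Build _ _ k k_zmod.
pose kS := GRing.isScalable.Build _ _ _ _ k k_scal.
pose kL : {linear unit_ev T' -> N} := HB.pack k kZ kS.
have hE x : h x = ehomQ f x *: h (1 : eringQ T).
  have -> : x = (x : eringQ T) *: (1 : (eringQ T)^o) :> unit_ev T.
    by rewrite /GRing.scale /= mulr1.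
  by rewrite linearZ /= /GRing.scale /= mulr1.
exists kL; split=> [x|k' k'E y]; first by rewrite [RHS]hE.
have -> : y = (y : eringQ T') *: (1 : (eringQ T')^o) :> unit_ev T'.
  by rewrite /GRing.scale /= mulr1.
rewrite !linearZ; congr (_ *: _).
have e1 : (1 : unit_ev T') = unit_tr (1 : eringQ T).
  by rewrite /= /unit_fun rmorph1.
by rewrite e1 k'E [RHS]/= /k /unit_fun rmorph1 scale1r.
Qed.

End Transition.

Lemma ehomQ_eq (T T' T'' : enlargement p B)
    (f : ehom T T') (g : ehom T' T'') (h : ehom T T'') :
  ehom_fun h =1 ehom_fun g \o ehom_fun f -> ehomQ h =1 ehomQ g \o ehomQ f.
Proof.
move=> hgf x; have [i pi1] := eloc_p T''.
have [k [a xE]] := eloc_frac x.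
have E : p%:R ^+ k * ehomQ h x = p%:R ^+ k * ehomQ g (ehomQ f x).
  have nat_pow (R R' : comNzRingType) (u : {rmorphism R -> R'}) y :
      p%:R ^+ k * u y = u (p%:R ^+ k * y).
    by rewrite rmorphM rmorphXn /= rmorph_nat.
  by rewrite !nat_pow xE !ehomQ_loc hgf.
have := congr1 ( *%R (i ^+ k)) E.
by rewrite !mulrA -exprMn [i * _]mulrC pi1 expr1n !mul1r.
Qed.

Lemma ehomQ_id (T : enlargement p B) (f : ehom T T) :
  ehom_fun f =1 id -> ehomQ f =1 id.
Proof.
move=> fid x; have [i pi1] := eloc_p T.
have [k [a xE]] := eloc_frac x.
have E : p%:R ^+ k * ehomQ f x = p%:R ^+ k * x.
  rewrite -{1}(rmorph_nat (ehomQ f)) -rmorphXn -rmorphM.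
  by rewrite /= xE ehomQ_loc fid.
have := congr1 ( *%R (i ^+ k)) E.
by rewrite !mulrA -exprMn [i * _]mulrC pi1 expr1n !mul1r.
Qed.

Definition isoc_unit : isocrystal p B := {|
  iev := unit_ev;
  iev_fg := unit_fg;
  itr := unit_tr;
  itr_id := ehomQ_id;
  itr_comp := ehomQ_eq;
  itr_base_change := unit_base_change
|}.

End Unit.

(* For phi : B -> C, i.e. Spec C -> Spec B: an enlargement of Spec C becomes one
   of Spec B by composing its structure map with Spec C -> Spec B, and
   (phi^* E)(T, z) = E(T, Spec phi \o z). *)
Section Pullback.

Variables (p : nat) (B C : comNzRingType) (phi : {rmorphism B -> C}).

Definition enl_comp (T : enlargement p C) : enlargement p B :=
  @Enlargement p B (ering T)
    (@ering_separated _ _ T) (@ering_complete _ _ T) (@ering_flat _ _ T)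
    (ering_finite_type T)
    (eringQ T) (eloc T) (@eloc_inj _ _ T) (eloc_p T) (@eloc_frac _ _ T)
    (ered T) (epi T) (@epi_surj _ _ T) (@epi_ker _ _ T)
    (estr T \o phi).

Definition ehom_comp (T T' : enlargement p C) (f : ehom T T') :
  ehom (enl_comp T) (enl_comp T') :=
  @EHom p B (enl_comp T) (enl_comp T') (ehom_fun f) (ehomQ f) (ehomQ_loc f)
    (ehom_red f) (ehom_red_pi f) (fun b => ehom_red_str f (phi b)).

Definition isoc_pullback (E : isocrystal p B) : isocrystal p C :=
  @Isocrystal p C
    (fun T => iev E (enl_comp T))
    (fun T => iev_fg E (enl_comp T))
    (fun T T' f => itr E (ehom_comp f))
    (fun T f fid => @itr_id _ _ E _ (ehom_comp f) fid)
    (fun T T' T'' f g h hgf => @itr_comp _ _ E _ _ _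
      (ehom_comp f) (ehom_comp g) (ehom_comp h) hgf)
    (fun T T' f => @itr_base_change _ _ E _ _ (ehom_comp f)).

End Pullback.

(* [pFrobenius_aut chB] is b |-> b ^+ p, the absolute Frobenius of Spec B. *)
Definition F_invariant (p : nat) (B : comNzRingType) (chB : p \in [pchar B])
    (N : isocrystal p B) : Prop :=
  isoc_iso (isoc_pullback (pFrobenius_aut chB) N) N.

Section Exactness.

Variables (p : nat) (B : comNzRingType).

(* Injectivity, surjectivity and exactness are those of sheaves of modules on
   the convergent site, hence tested on sections over affine enlargements. *)
Definition isoc_injective (E E' : isocrystal p B) (u : isoc_hom E E') : Prop :=
  forall T, injective (ihom u T).

Definition isoc_surjective (E E' : isocrystal p B) (u : isoc_hom E E') : Prop :=
  forall T y, exists x, ihom u T x = y.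

Definition short_exact (E' E E'' : isocrystal p B)
    (i : isoc_hom E' E) (q : isoc_hom E E'') : Prop :=
  [/\ isoc_injective i, isoc_surjective q
    & forall T x, ihom q T x = 0 <-> exists y, ihom i T y = x].

Definition subquotient (M N : isocrystal p B) : Prop :=
  exists (P : isocrystal p B) (j : isoc_hom P N) (s : isoc_hom P M),
    isoc_injective j /\ isoc_surjective s.

End Exactness.

(* The coordinate ring of the affine line over F_p. *)
Notation A1 p := {poly 'F_p}.

Lemma pchar_A1 (p : nat) : prime p -> p \in [pchar (A1 p)].
Proof. by move=> p_pr; rewrite pchar_poly pchar_Fp. Qed.

(* Main.v *)
Require Import Defs.
From HB Require Import structures.
From mathcomp Require Import all_boot all_order all_algebra.
From mathcomp Require Import boolp ring zify.

Set Implicit Arguments.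
Unset Strict Implicit.
Unset Printing Implicit Defensive.

Import GRing.Theory.
Local Open Scope ring_scope.

(** Every extension of the unit isocrystal by itself over the affine line comes
    from a power series F with F' in the Tate algebra, F being a primitive of the
    connection form; the extension is described by the differences F(x) - F(y),
    which make sense for functions x, y that agree on the reduced subscheme.
    Frobenius pullback replaces F(t) by F(t^p). The extension M used here is that
    of a lacunary series, F = sum of the t^(p^k) for k a power of 2, whose
    differences converge p-adically because x^(p^k) - y^(p^k) tends to 0 as soon
    as x - y is nilpotent modulo p ([lacunary_cocycle]). Its iterated Frobenius
    pullbacks M_n correspond to F_n = F(t^(p^n)).

    If M is a subquotient of a Frobenius-invariant N, then so are all the M_n
    ([lext_subquotient_orbit]). Restrict N to a small disc, here
    the disc t = p u around the origin: there M_n has the flat section with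
    coordinates (-F_n, 1), and this section lifts to a flat section of a
    subobject of N. Over Q_p<t>, up to a nonzero factor, the first coordinate of
    M_n extends to a linear functional on the sections of N
    ([domain_extend]), so that F_n is, up to such factors and to an element of
    Q_p<t>, the value of a functional on N at a flat section of N. The
    functionals and the flat sections form modules of finite rank, hence the
    periods F_n satisfy a nontrivial linear relation over Q_p<t> modulo Q_p<t>
    ([lext_period_relation]). This avoids the Tannakian form of the argument, in
    which the classes of the M_n would lie in the finite-dimensional space of
    homomorphisms from the monodromy group of N to the additive group.

    No such relation exists: after division by a power of p its coefficients
    have a nonzero reduction in F_p[t], the relation itself reduces to one
    between power series over F_p ([tate_contract_pdvd]), and the gaps in the
    exponents of the F_n exclude it ([lacunary_independent]).

    Flat sections never appear as such. Specializing at the origin is an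
    endomorphism h of this disc, seen as an enlargement of the affine line; the
    image of a section under the transition map of h is the flat section with
    the same value at the origin. Thus the only enlargements needed are given by
    Z_p<t>, and the transition maps of t |-> p t and of t |-> 0 carry the whole
    argument. *)

(** * Divisibility by powers of p *)

Section Divisibility.

Variables (p : nat) (A : comNzRingType).
Implicit Types (x y z : A) (k j : nat).

Lemma pdvd0 k : pdvd p k (0 : A).
Proof. by exists 0; rewrite mulr0. Qed.

Lemma pdvd_0 x : pdvd p 0 x.
Proof. by exists x; rewrite mul1r. Qed.

Lemma pdvdD k x y : pdvd p k x -> pdvd p k y -> pdvd p k (x + y).
Proof. by move=> [a ->] [b ->]; exists (a + b); rewrite mulrDr. Qed.

Lemma pdvdN k x : pdvd p k x -> pdvd p k (- x).
Proof. by move=> [a ->]; exists (- a); rewrite mulrN. Qed.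

Lemma pdvdB k x y : pdvd p k x -> pdvd p k y -> pdvd p k (x - y).
Proof. by move=> hx /pdvdN; apply: pdvdD. Qed.

Lemma pdvdMl k x y : pdvd p k y -> pdvd p k (x * y).
Proof. by move=> [b ->]; exists (x * b); rewrite mulrCA. Qed.

Lemma pdvdMr k x y : pdvd p k x -> pdvd p k (x * y).
Proof. by rewrite mulrC; apply: pdvdMl. Qed.

Lemma pdvdM k j x y : pdvd p k x -> pdvd p j y -> pdvd p (k + j) (x * y).
Proof. by move=> [a ->] [b ->]; exists (a * b); rewrite exprD mulrACA. Qed.

Lemma pdvd_le j k x : (j <= k)%N -> pdvd p k x -> pdvd p j x.
Proof.
by move=> /subnKC <- [a ->]; exists (p%:R ^+ (k - j) * a); rewrite exprD mulrA.
Qed.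

Lemma pdvd_exp k : pdvd p k (p%:R ^+ k : A).
Proof. by exists 1; rewrite mulr1. Qed.

Lemma pdvd_nat k n : (p ^ k %| n)%N -> pdvd p k (n%:R : A).
Proof. by move=> /dvdnP[m ->]; exists m%:R; rewrite natrM natrX mulrC. Qed.

Lemma pdvd_sum k (I : Type) (r : seq I) (P : pred I) (F : I -> A) :
  (forall i, P i -> pdvd p k (F i)) -> pdvd p k (\sum_(i <- r | P i) F i).
Proof. by move=> h; elim/big_ind: _ => //; [apply: pdvd0|apply: pdvdD]. Qed.

Lemma pdvd_trans k y x z :
  pdvd p k (x - y) -> pdvd p k (y - z) -> pdvd p k (x - z).
Proof. by move=> h1 h2; have := pdvdD h1 h2; rewrite addrA subrK. Qed.

Lemma pdvd_sym k x y : pdvd p k (x - y) -> pdvd p k (y - x).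
Proof. by move=> /pdvdN; rewrite opprB. Qed.

Lemma pdvd_regl k x y : p_torsion_free p A ->
  p%:R ^+ k * x = p%:R ^+ k * y -> x = y.
Proof.
move=> tf /eqP; rewrite -subr_eq0 -mulrBr => /eqP.
elim: k => [|k IH]; first by rewrite mul1r => /subr0_eq.
by rewrite exprS -mulrA => /tf.
Qed.

End Divisibility.

Lemma pdvd_morph (p : nat) (A A' : comNzRingType) (f : {rmorphism A -> A'}) k x :
  pdvd p k x -> pdvd p k (f x).
Proof. by move=> [a ->]; exists (f a); rewrite rmorphM rmorphXn rmorph_nat. Qed.

(** * p-adic limits *)

Section Limits.

Variables (p : nat) (A : comNzRingType).
Implicit Types (u v : nat -> A) (l : A).

Definition padic_lim u l := forall k, exists N, forall M,
  (N <= M)%N -> pdvd p k (l - u M).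

Lemma padic_lim_unique u l l' : padic_separated p A ->
  padic_lim u l -> padic_lim u l' -> l = l'.
Proof.
move=> sep hl hl'; apply/subr0_eq/sep => k.
have [N hN] := hl k; have [N' hN'] := hl' k.
apply: (@pdvd_trans _ _ _ (u (maxn N N'))); first by apply/hN/leq_maxl.
by apply/pdvd_sym/hN'/leq_maxr.
Qed.

Lemma padic_limB u v l m :
  padic_lim u l -> padic_lim v m -> padic_lim (fun k => u k - v k) (l - m).
Proof.
move=> hu hv k; have [N hN] := hu k; have [N' hN'] := hv k.
exists (maxn N N') => M; rewrite geq_max => /andP[/hN h /hN' h'].
by have := pdvdB h h'; congr pdvd; ring.
Qed.

Lemma padic_lim_cst l : padic_lim (fun=> l) l.
Proof. by move=> k; exists 0%N => M _; rewrite subrr; apply: pdvd0. Qed.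

(** The hypothesis is offset by a constant because the terms of the series below
    only start being divisible by p once a power of p has absorbed the
    nilpotence. *)
Lemma padic_lim_exists u m : padic_complete p A ->
  (forall k, pdvd p k (u (k + m).+1 - u (k + m)%N)) -> exists l, padic_lim u l.
Proof.
move=> cpl hu; have [l hl] := cpl (fun k => u (k + m)%N) hu.
exists l => k; exists (k + m)%N => M /subnKC <-; rewrite addnAC.
by apply: (pdvd_le _ (hl _)); rewrite leq_addr.
Qed.

Lemma padic_lim_pdvd u l x K M :
  padic_lim u l -> (forall M', (M <= M')%N -> pdvd p K (u M' - x)) ->
  pdvd p K (l - x).
Proof.
move=> /(_ K)[N hN] hx; apply: (pdvd_trans (hN (maxn N M) (leq_maxl _ _))).
exact/hx/leq_maxr.
Qed.

End Limits.

Lemma padic_lim_morph (p : nat) (A A' : comNzRingType) (f : {rmorphism A -> A'})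
    u l :
  padic_lim p u l -> padic_lim p (f \o u) (f l).
Proof.
move=> h k; have [N hN] := h k; exists N => M.
by move=> /hN/(pdvd_morph f); rewrite rmorphB.
Qed.

(** * The lacunary cocycle *)

(** The powers of 2; any set with gaps tending to infinity would do. *)
Definition lacunary (k : nat) : bool := k == (2 ^ trunc_log 2 k)%N.

Section Cocycle.

Variables (p : nat) (A : comNzRingType).
Hypothesis p_pr : prime p.
Implicit Types (x y z : A).

Lemma pdvd_frobD k x y :
  pdvd p 1 ((x + y) ^+ (p ^ k) - (x ^+ (p ^ k) + y ^+ (p ^ k))).
Proof.
have frob1 a b : pdvd p 1 ((a + b) ^+ p - (a ^+ p + b ^+ p) : A).
  have p_gt0 := prime_gt0 p_pr.
  rewrite exprDn -(big_mkord xpredT (fun i => a ^+ (p - i) * b ^+ i *+ 'C(p, i))).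
  rewrite big_nat_recr //= big_ltn //= subn0 subnn bin0 binn !mulr1n mul1r mulr1.
  rewrite [_ + _ - _](_ : _ =
    \sum_(1 <= i < p) a ^+ (p - i) * b ^+ i *+ 'C(p, i)); last by ring.
  rewrite big_nat_cond; apply: pdvd_sum => i /andP[/andP[i_gt0 i_lt] _].
  rewrite -mulr_natr; apply/pdvdMl/pdvd_nat; rewrite expn1.
  by apply: prime_dvd_bin => //; rewrite i_gt0.
elim: k => [|k IH]; first by rewrite !expr1 subrr; apply: pdvd0.
rewrite expnSr !exprM.
apply: (pdvd_trans _ (frob1 _ _)).
by rewrite subrXX; apply: pdvdMr.
Qed.

(** The factor gained is the cofactor of x - y in x^p - y^p, a sum of p terms all
    congruent to y^(p-1) modulo p. *)
Lemma pdvd_expp j x y :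
  (0 < j)%N -> pdvd p j (x - y) -> pdvd p j.+1 (x ^+ p - y ^+ p).
Proof.
move=> j_gt0 hxy; rewrite subrXX -addn1; apply: pdvdM => //.
have [c ->] : exists c, x = y + p%:R * c.
  have [c hc] := pdvd_le j_gt0 hxy.
  by exists c; rewrite -[X in X * c]expr1 -hc; ring.
have hterm i : pdvd p 1 ((y + p%:R * c) ^+ i - y ^+ i).
  by rewrite subrXX; apply: pdvdMr; exists c; rewrite expr1; ring.
have -> : \sum_(i < p) (y + p%:R * c) ^+ (p.-1 - i) * y ^+ i =
    \sum_(i < p) ((y + p%:R * c) ^+ (p.-1 - i) - y ^+ (p.-1 - i)) * y ^+ i
    + \sum_(i < p) y ^+ (p.-1).
  rewrite -big_split; apply: eq_bigr => i _ /=; rewrite mulrBl -exprD.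
  rewrite subnK ?subrK //.
  by have := ltn_ord i; lia.
apply: pdvdD; first by apply: pdvd_sum => i _; apply/pdvdMr/hterm.
by rewrite sumr_const card_ord -mulr_natr; apply/pdvdMl/pdvd_nat; rewrite expn1.
Qed.

(** Equality in the reduced ring A / sqrt(pA). *)
Definition padic_near x y := exists n, pdvd p 1 ((x - y) ^+ n).

Lemma padic_near_pdvd x y : pdvd p 1 (x - y) -> padic_near x y.
Proof. by exists 1. Qed.

(** Once a power of Frobenius has absorbed the nilpotence, every further power
    gains a factor p. *)
Lemma padic_near_expp x y : padic_near x y ->
  exists m, forall k, pdvd p k.+1 (x ^+ (p ^ (k + m)) - y ^+ (p ^ (k + m))).
Proof.
move=> [n hn]; exists n; elim=> [|k IH]; last first.
  by rewrite addSn expnSr !exprM; apply: pdvd_expp.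
rewrite add0n; have := pdvd_frobD n (x - y) y; rewrite subrK.
have : pdvd p 1 ((x - y) ^+ (p ^ n)).
  have /subnKC <- : (n <= p ^ n)%N by apply/ltnW/ltn_expl/prime_gt1.
  by rewrite exprD; apply: pdvdMr.
by move=> h1 /pdvdD/(_ h1); congr pdvd; ring.
Qed.

Definition lacunary_sum x y M :=
  \sum_(k < M | lacunary k) (x ^+ (p ^ k) - y ^+ (p ^ k)).

(** The difference F(x) - F(y) of two values of the lacunary series F, which may
    converge although neither value does. *)
Definition lacunary_cocycle x y : A :=
  if pselect (exists l, padic_lim p (lacunary_sum x y) l) is left ex
  then projT1 (cid ex) else 0.

Hypotheses (sepA : padic_separated p A) (cplA : padic_complete p A).

Lemma lacunary_cocycle_lim x y : padic_near x y ->
  padic_lim p (lacunary_sum x y) (lacunary_cocycle x y).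
Proof.
move=> /padic_near_expp[m hm].
suff ex : exists l, padic_lim p (lacunary_sum x y) l.
  by rewrite /lacunary_cocycle; case: pselect => // ex'; case: cid.
apply: (padic_lim_exists (m := m) cplA) => k.
rewrite /lacunary_sum big_mkcond [X in _ - X]big_mkcond big_ord_recr /=.
rewrite addrAC subrr add0r.
by case: ifP => _; [apply: pdvd_le (hm k)|apply: pdvd0].
Qed.

Lemma lacunary_cocycle_unique x y l :
  padic_near x y -> padic_lim p (lacunary_sum x y) l -> lacunary_cocycle x y = l.
Proof. by move=> /lacunary_cocycle_lim; apply: padic_lim_unique. Qed.

Lemma padic_near_trans x y z : padic_near x y -> padic_near y z -> padic_near x z.
Proof.
move=> [n hn] [m hm].
have [k [nk mk]] : exists k, (n <= p ^ k /\ m <= p ^ k)%N.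
  exists (n + m)%N.
  have := ltn_expl (n + m) (prime_gt1 p_pr); lia.
exists (p ^ k)%N; have := pdvd_frobD k (x - y) (y - z).
rewrite addrA subrK => h.
rewrite -[X in pdvd _ _ X](subrK ((x - y) ^+ (p ^ k) + (y - z) ^+ (p ^ k))).
apply: pdvdD => //; apply: pdvdD.
  by rewrite -(subnKC nk) exprD; apply: pdvdMr.
by rewrite -(subnKC mk) exprD; apply: pdvdMr.
Qed.

Lemma padic_near_sym x y : padic_near x y -> padic_near y x.
Proof.
move=> [n hn]; exists n; rewrite -opprB exprNn; exact: pdvdMl.
Qed.

Lemma lacunary_cocycle_trans x y z : padic_near x y -> padic_near y z ->
  lacunary_cocycle x z = lacunary_cocycle x y + lacunary_cocycle y z.
Proof.
move=> xy yz; apply: lacunary_cocycle_unique; first exact: padic_near_trans yz.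
have := padic_limB (lacunary_cocycle_lim xy)
  (padic_limB (padic_lim_cst p 0) (lacunary_cocycle_lim yz)).
rewrite sub0r opprK; congr padic_lim; apply/funext => M.
by rewrite sub0r opprK -big_split; apply: eq_bigr => k _ /=; rewrite addrA subrK.
Qed.

Lemma padic_near_refl x : padic_near x x.
Proof. by apply: padic_near_pdvd; rewrite subrr; apply: pdvd0. Qed.

Lemma lacunary_cocyclexx x : lacunary_cocycle x x = 0.
Proof.
apply: lacunary_cocycle_unique; first exact: padic_near_refl.
have := padic_lim_cst p (0 : A); congr padic_lim; apply/funext => M.
by rewrite /lacunary_sum big1 // => k _; rewrite subrr.
Qed.

End Cocycle.

Lemma padic_near_morph (p : nat) (A A' : comNzRingType)
    (f : {rmorphism A -> A'}) x y :
  padic_near p x y -> padic_near p (f x) (f y).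
Proof.
by move=> [n hn]; exists n; rewrite -rmorphB -rmorphXn; apply: pdvd_morph.
Qed.

Lemma lacunary_cocycle_morph (p : nat) (A A' : comNzRingType)
    (f : {rmorphism A -> A'}) x y : prime p ->
  padic_separated p A -> padic_complete p A ->
  padic_separated p A' -> padic_complete p A' ->
  padic_near p x y ->
  lacunary_cocycle p (f x) (f y) = f (lacunary_cocycle p x y).
Proof.
move=> p_pr sep cpl sep' cpl' xy; apply: lacunary_cocycle_unique => //.
  exact: padic_near_morph.
have := padic_lim_morph f (lacunary_cocycle_lim p_pr cpl xy).
congr padic_lim; apply/funext => M; rewrite /= rmorph_sum.
by apply: eq_bigr => k _; rewrite rmorphB !rmorphXn.
Qed.

(** * The extension defined by a lifting of a function *)

Section LacunaryExtension.

Variables (p : nat) (p_pr : prime p) (B : comNzRingType) (e : B).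

Lemma epi_near (T : enlargement p B) (x y : ering T) :
  epi T x = epi T y -> padic_near p x y.
Proof. by move=> E; apply/epi_ker; rewrite rmorphB E subrr. Qed.

(** No coherence between different enlargements is asked for: the cocycle below
    measures its failure. *)
Definition lifting (s : forall T : enlargement p B, ering T) : Prop :=
  forall T, epi T (s T) = estr T e.

Variables (s : forall T : enlargement p B, ering T) (s_lift : lifting s).

(** This is F(f^* s_T) - F(s_T'), where F is the lacunary series. *)
Definition lext_cocycle (T T' : enlargement p B) (f : ehom T T') : eringQ T' :=
  eloc T' (lacunary_cocycle p (ehom_fun f (s T)) (s T')).

Lemma lifting_near (T T' : enlargement p B) (f : ehom T T') :
  padic_near p (ehom_fun f (s T)) (s T').
Proof.
by apply: epi_near; rewrite -ehom_red_pi !s_lift ehom_red_str.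
Qed.

Definition lext_ev (T : enlargement p B) : lmodType (eringQ T) :=
  ((eringQ T)^o * (eringQ T)^o)%type.

Lemma lext_evE (T : enlargement p B) (x : lext_ev T) :
  x = (x.1 : eringQ T) *: (1, 0) + (x.2 : eringQ T) *: (0, 1).
Proof.
case: x => a b; rewrite /GRing.scale /= /scale_pair /GRing.add /= /add_pair /=.
by rewrite !scaler0 addr0 add0r /GRing.scale /= !mulr1.
Qed.

Lemma lext_fg (T : enlargement p B) : finitely_generated (lext_ev T).
Proof.
exists 2, (fun i => if val i == 0 then (1, 0) else (0, 1)) => x.
exists (fun i => if val i == 0 then x.1 else x.2).
by rewrite !big_ord_recl big_ord0 /= addr0 -lext_evE.
Qed.

Section Transition.

Variables (T T' : enlargement p B) (f : ehom T T').

Definition lext_fun (x : lext_ev T) : lext_ev T' :=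
  (ehomQ f x.1 + lext_cocycle f * ehomQ f x.2, ehomQ f x.2).

Fact lext_fun_zmod : zmod_morphism lext_fun.
Proof.
move=> x y; rewrite /lext_fun /=; congr pair; last exact: (rmorphB (ehomQ f)).
rewrite (rmorphB (ehomQ f) x.1 y.1) (rmorphB (ehomQ f) x.2 y.2) mulrBr.
rewrite [RHS](_ : _ = ehomQ f x.1 + lext_cocycle f * ehomQ f x.2
  - (ehomQ f y.1 + lext_cocycle f * ehomQ f y.2)) //.
by rewrite opprD addrACA.
Qed.

Fact lext_fun_scalable : scalable_for (ehomQ f \; *:%R) lext_fun.
Proof.
move=> a x; rewrite /lext_fun /=; congr pair; last exact: (rmorphM (ehomQ f)).
rewrite (rmorphM (ehomQ f) a x.1) (rmorphM (ehomQ f) a x.2).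
by rewrite [RHS]mulrDr mulrCA.
Qed.

HB.instance Definition _ :=
  GRing.isZmodMorphism.Build (lext_ev T) (lext_ev T') lext_fun lext_fun_zmod.
HB.instance Definition _ :=
  GRing.isScalable.Build (eringQ T) (lext_ev T) (lext_ev T')
    (ehomQ f \; *:%R) lext_fun lext_fun_scalable.

Definition lext_tr : {linear lext_ev T -> lext_ev T' | ehomQ f \; *:%R} :=
  lext_fun.

(** The transition matrix is unipotent, so the images of the two basis vectors
    form a basis again. *)
Lemma lext_base_change : is_base_change lext_tr.
Proof.
move=> N h; pose c := lext_cocycle f.
pose h1 := h ((1, 0) : lext_ev T); pose h2 := h ((0, 1) : lext_ev T).
pose k (y : lext_ev T') : N :=
  (y.1 : eringQ T') *: h1 + (y.2 : eringQ T') *: (h2 - c *: h1).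
have k_zmod : zmod_morphism k.
  by move=> x y; rewrite /k /= !scalerBl opprD addrACA.
have k_scal : scalable k by move=> a x; rewrite /k [RHS]scalerDr !(scalerA a).
pose kZ := GRing.isZmodMorphism.Build _ _ k k_zmod.
pose kS := GRing.isScalable.Build _ _ _ _ k k_scal.
pose kL : {linear lext_ev T' -> N} := HB.pack k kZ kS.
have hE x : h x = ehomQ f x.1 *: h1 + ehomQ f x.2 *: h2.
  by rewrite {1}(lext_evE x) linearD !linearZ.
have kE x : kL (lext_tr x) = h x.
  rewrite hE /= /k /= -/c scalerDl -addrA; congr (_ + _).
  by rewrite scalerBr scalerA mulrC addrC subrK.
exists kL; split=> // k' k'E y.
have e1 : ((1, 0) : lext_ev T') = lext_tr ((1, 0) : lext_ev T).
  by rewrite /= /lext_fun /= rmorph0 mulr0 addr0 rmorph1.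
have e2 : ((0, 1) : lext_ev T') =
    lext_tr ((0, 1) : lext_ev T) - c *: ((1, 0) : lext_ev T').
  rewrite /= /lext_fun /= rmorph0 rmorph1 mulr1 add0r.
  by rewrite /GRing.scale /= /scale_pair scaler0 /GRing.scale /= mulr1;
     congr pair => /=; rewrite -?/c ?subrr ?subr0.
have b1 : k' (1, 0) = kL (1, 0) by rewrite e1 k'E kE.
have b2 : k' (0, 1) = kL (0, 1) by rewrite e2 !linearB !linearZ b1 k'E kE.
by rewrite (lext_evE y) !linearD !linearZ b1 b2.
Qed.

End Transition.

Lemma lext_tr_id (T : enlargement p B) (f : ehom T T) :
  ehom_fun f =1 id -> lext_tr f =1 id.
Proof.
move=> fid x; rewrite /= /lext_fun !(ehomQ_id fid) /lext_cocycle fid.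
rewrite lacunary_cocyclexx ?rmorph0 ?mul0r ?addr0; first by case: x.
- exact: p_pr.
- exact: ering_separated.
- exact: ering_complete.
Qed.

Lemma lext_tr_comp (T T' T'' : enlargement p B)
    (f : ehom T T') (g : ehom T' T'') (h : ehom T T'') :
  ehom_fun h =1 ehom_fun g \o ehom_fun f -> lext_tr h =1 lext_tr g \o lext_tr f.
Proof.
move=> hgf x; rewrite /= /lext_fun /= !(ehomQ_eq hgf) /=; congr pair.
rewrite rmorphD rmorphM -addrA -mulrDl /lext_cocycle ehomQ_loc -rmorphD hgf /=.
rewrite -(lacunary_cocycle_morph (ehom_fun g)) //;
  [| exact: ering_separated | exact: ering_complete
   | exact: ering_separated | exact: ering_complete | exact: lifting_near].
rewrite -lacunary_cocycle_trans //;
  [exact: ering_separated | exact: ering_complete | | exact: lifting_near].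
exact/padic_near_morph/lifting_near.
Qed.

Definition lext : isocrystal p B := {|
  iev := lext_ev;
  iev_fg := lext_fg;
  itr := lext_tr;
  itr_id := lext_tr_id;
  itr_comp := lext_tr_comp;
  itr_base_change := lext_base_change
|}.

Lemma lext_trE (T T' : enlargement p B) (f : ehom T T') (x : iev lext T) :
  itr lext f x = (ehomQ f x.1 + lext_cocycle f * ehomQ f x.2, ehomQ f x.2).
Proof. by []. Qed.

Section Inclusion.

Variable T : enlargement p B.

Definition lext_in (a : unit_ev T) : lext_ev T := (a, 0).

Fact lext_in_zmod : zmod_morphism lext_in.
Proof. by move=> x y; congr pair; rewrite subrr. Qed.

Fact lext_in_scalable : scalable lext_in.
Proof. by move=> a x; congr pair; rewrite /= scaler0. Qed.

HB.instance Definition _ :=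
  GRing.isZmodMorphism.Build (unit_ev T) (lext_ev T) lext_in lext_in_zmod.
HB.instance Definition _ :=
  GRing.isScalable.Build (eringQ T) (unit_ev T) (lext_ev T) *:%R lext_in
    lext_in_scalable.

Definition lext_out (x : lext_ev T) : unit_ev T := x.2.

Fact lext_out_zmod : zmod_morphism lext_out.
Proof. by []. Qed.

Fact lext_out_scalable : scalable lext_out.
Proof. by []. Qed.

HB.instance Definition _ :=
  GRing.isZmodMorphism.Build (lext_ev T) (unit_ev T) lext_out lext_out_zmod.
HB.instance Definition _ :=
  GRing.isScalable.Build (eringQ T) (lext_ev T) (unit_ev T) *:%R lext_out
    lext_out_scalable.

End Inclusion.

Definition lext_incl : isoc_hom (isoc_unit p B) lext.
Proof.
apply: (@IsocHom p B (isoc_unit p B) lext (fun T => lext_in (T := T))) => T T' f x.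
by rewrite /= /lext_fun /= rmorph0 mulr0 addr0.
Defined.

Definition lext_proj : isoc_hom lext (isoc_unit p B).
Proof.
by apply: (@IsocHom p B lext (isoc_unit p B) (fun T => lext_out (T := T))).
Defined.

Lemma lext_exact : short_exact lext_incl lext_proj.
Proof.
split=> [T x y [] //|T y|T [a b]]; first by exists (0, y).
by split=> [/= -> |[y [_ <-]]] //; exists a.
Qed.

End LacunaryExtension.

(** * Subquotients of Frobenius-invariant isocrystals *)

Section Subquotients.

Variables (p : nat) (B C : comNzRingType) (phi : {rmorphism B -> C}).

Definition isoc_hom_pullback (E E' : isocrystal p B) (u : isoc_hom E E') :
    isoc_hom (isoc_pullback phi E) (isoc_pullback phi E') :=
  @IsocHom p C (isoc_pullback phi E) (isoc_pullback phi E')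
    (fun T => ihom u (enl_comp phi T))
    (fun T T' f x => ihom_nat u (ehom_comp phi f) x).

Lemma isoc_hom_comp (E E' E'' : isocrystal p B)
    (u : isoc_hom E' E'') (v : isoc_hom E E') :
  exists w : isoc_hom E E'', forall T x, ihom w T x = ihom u T (ihom v T x).
Proof.
have nat_uv T T' (f : ehom T T') x :
    (ihom u T' \o ihom v T') (itr E f x) = itr E'' f ((ihom u T \o ihom v T) x).
  by rewrite /= !ihom_nat.
by exists (@IsocHom _ _ _ _ (fun T => ihom u T \o ihom v T) nat_uv).
Qed.

Lemma subquotient_iso (M N N' : isocrystal p B) :
  isoc_iso N N' -> subquotient M N -> subquotient M N'.
Proof.
move=> [u [v [uK _]]] [P [j [s [j_inj s_surj]]]].
have [w wE] := isoc_hom_comp u j; exists P, w, s; split=> // T x y.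
by rewrite !wE => /(can_inj (uK T)); apply: j_inj.
Qed.

End Subquotients.

Section FrobeniusOrbit.

Variables (p : nat) (p_pr : prime p) (B : comNzRingType) (e : B).
Variables (chB : p \in [pchar B]).
Variables (s : forall T : enlargement p B, ering T) (s_lift : lifting e s).
Let F := pFrobenius_aut chB.

Lemma lifting_pullback : lifting (e ^+ p) (fun T => s (enl_comp F T)).
Proof. by move=> T; rewrite (s_lift (enl_comp F T)). Qed.

(** The Frobenius pullback of the extension attached to e is the extension
    attached to e^p. *)
Lemma lext_subquotient_Frobenius (N : isocrystal p B) : F_invariant chB N ->
  subquotient (lext p_pr s_lift) N -> subquotient (lext p_pr lifting_pullback) N.
Proof.
move=> NF [P [j [q [j_inj q_surj]]]]; apply: subquotient_iso NF _.
pose q' T : {linear iev (isoc_pullback F P) T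
    -> iev (lext p_pr lifting_pullback) T} := ihom q (enl_comp F T).
have q'_nat T T' (f : ehom T T') (x : iev (isoc_pullback F P) T) :
    q' T' (itr (isoc_pullback F P) f x) =
    itr (lext p_pr lifting_pullback) f (q' T x).
  exact: (ihom_nat q (ehom_comp F f) x).
exists (isoc_pullback F P), (isoc_hom_pullback F j), (IsocHom q'_nat).
split=> T; [exact: (j_inj (enl_comp F T))|exact: (q_surj (enl_comp F T))].
Qed.

End FrobeniusOrbit.

Lemma lext_subquotient_orbit (p : nat) (p_pr : prime p) (B : comNzRingType)
    (e : B) (chB : p \in [pchar B]) (s : forall T : enlargement p B, ering T)
    (s_lift : lifting e s) (N : isocrystal p B) :
  F_invariant chB N -> subquotient (lext p_pr s_lift) N ->
  forall n, exists (s' : forall T : enlargement p B, ering T)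
    (s'_lift : lifting (e ^+ (p ^ n)) s'), subquotient (lext p_pr s'_lift) N.
Proof.
move=> NF Ms; elim=> [|n [s' [s'_lift sub]]]; first by exists s, s_lift.
rewrite expnSr exprM; exists (fun T => s' (enl_comp (pFrobenius_aut chB) T)).
by exists (lifting_pullback chB s'_lift); apply: lext_subquotient_Frobenius.
Qed.

(** * Linear algebra over a domain *)

Section Domain.

Variable K : comNzRingType.
Hypothesis domK : GRing.integral_domain_axiom K.

Lemma domain_mul_neq0 (x y : K) : x != 0 -> y != 0 -> x * y != 0.
Proof.
by move=> x0 y0; apply/eqP => /domK; rewrite (negPf x0) (negPf y0).
Qed.

Lemma domain_dependent m r (a : 'I_r -> 'I_m -> K) : (m < r)%N ->
  exists u : 'I_r -> K, (exists n, u n != 0) /\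
    forall i, \sum_n u n * a n i = 0.
Proof.
elim: m r a => [|m IH] [//|r] a lt_mr.
  by exists (fun=> 1); split=> [|[]//]; exists ord0; apply: oner_neq0.
have [[n0 an0]|/forallNP a0] := EM (exists n, a n ord0 != 0); last first.
  have [u [u0 uE]] := IH r.+1 (fun n i => a n (lift ord0 i)) (ltnW lt_mr).
  exists u; split=> // i; case: (unliftP ord0 i) => [j ->|->]; first exact: uE.
  by rewrite big1 // => n _; have /negP/negPn/eqP -> := a0 n; rewrite mulr0.
pose a' n i := a n0 ord0 * a (lift n0 n) (lift ord0 i)
  - a (lift n0 n) ord0 * a n0 (lift ord0 i).
have [u [[n un] uE]] := IH r a' lt_mr.
pose v k := if unlift n0 k is Some n then u n * a n0 ord0
  else - \sum_n u n * a (lift n0 n) ord0.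
exists v; split; first by exists (lift n0 n); rewrite /v liftK domain_mul_neq0.
move=> i; rewrite (bigD1_ord n0) //= /v unlift_none.
under eq_bigr do rewrite liftK.
rewrite mulNr mulr_suml; case: (unliftP ord0 i) => [j ->|->].
  rewrite addrC -sumrB -[RHS](uE j); apply: eq_bigr => k _; rewrite /a'; ring.
by rewrite addrC -sumrB big1 // => k _; ring.
Qed.

(** A functional on a submodule of K^d, given by its graph, extends to K^d after
    multiplication by a nonzero scalar. *)
Lemma domain_extend_graph d (G : ('I_d -> K) -> K -> Prop) :
  (forall u v x y a b, G x a -> G y b ->
     G (fun i => u * x i + v * y i) (u * a + v * b)) ->
  (forall a, G (fun=> 0) a -> a = 0) ->
  exists g (l : 'I_d -> K), g != 0 /\
    forall x a, G x a -> g * a = \sum_i l i * x i.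
Proof.
elim: d G => [|d IH] G Glin G0.
  exists 1, (fun=> 0); split=> [|x a Gxa]; first exact: oner_neq0.
  rewrite big_ord0 mul1r; apply: G0; have -> // : (fun=> 0) = x.
  by apply/funext; case.
pose ext (x : 'I_d -> K) i := oapp x 0 (unlift ord0 i).
have ext0 x : ext x ord0 = 0 by rewrite /ext unlift_none.
have extS x i : ext x (lift ord0 i) = x i by rewrite /ext liftK.
have extE x : x ord0 = 0 -> ext (fun i => x (lift ord0 i)) = x.
  move=> x0; apply/funext => i.
  by case: (unliftP ord0 i) => [j ->|->]; rewrite ?extS // ext0.
have [g [l [g0 lE]]] : exists g (l : 'I_d -> K), g != 0 /\
    forall x a, G (ext x) a -> g * a = \sum_i l i * x i.
  apply: (IH (fun x a => G (ext x) a)) => [u v x y a b Gx Gy|a].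
    have := Glin u v _ _ _ _ Gx Gy; congr G; apply/funext => i.
    by case: (unliftP ord0 i) => [j ->|->]; rewrite ?extS // !ext0 !mulr0 addr0.
  have -> : ext (fun=> 0) = fun=> 0; last exact: G0.
  by apply/funext => i; case: (unliftP ord0 i) => [j ->|->]; rewrite ?extS ?ext0.
have [[x1 [a1 [G1 u0]]]|/forallNP noG] :=
    EM (exists x a, G x a /\ x ord0 != 0); last first.
  exists g, (ext l); split=> // x a Gx.
  have x0 : x ord0 = 0.
    by apply/eqP/negPn/negP => x0; apply: (noG x); exists a.
  rewrite big_ord_recl x0 mulr0 add0r.
  rewrite (lE (fun i => x (lift ord0 i))) ?extE //.
  by apply: eq_bigr => i _; rewrite extS.
pose u := x1 ord0.
(* Eliminating the first coordinate of (x, a) against (x1, a1) leaves an element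
   to which the induction hypothesis applies; m is the value forced on the
   first basis vector. *)
pose m := g * a1 - \sum_i l i * x1 (lift ord0 i).
exists (g * u), (fun i => if unlift ord0 i is Some j then u * l j else m).
split=> [|x a Gx]; first exact: domain_mul_neq0.
pose y i := u * x i + (- x ord0) * x1 i.
have y0 : y ord0 = 0 by rewrite /y /u; ring.
have Gy : G (ext (fun i => y (lift ord0 i))) (u * a + (- x ord0) * a1).
  by rewrite extE //; apply: Glin.
have := lE _ _ Gy; rewrite mulrDr => gE.
have -> : g * u * a = g * (u * a) by ring.
rewrite (canRL (addrK _) gE) big_ord_recl unlift_none /m.
under eq_bigr do rewrite /y mulrDr.
rewrite big_split /=.
rewrite [X in _ = _ + X](eq_bigr (fun i => l i * (u * x (lift ord0 i)))).
  have -> : \sum_i l i * (- x ord0 * x1 (lift ord0 i)) =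
      - x ord0 * \sum_i l i * x1 (lift ord0 i).
    by rewrite mulr_sumr; apply: eq_bigr => i _; ring.
  ring.
by move=> i _; rewrite liftK; ring.
Qed.

Lemma domain_extend (N P : lmodType K) (j : {linear P -> N})
    (a : {linear P -> K^o}) :
  finitely_generated N -> injective j ->
  exists (g : K) (l : {linear N -> K^o}), g != 0 /\
    forall x, l (j x) = g * (a x : K) :> K.
Proof.
move=> [d [e eN]] j_inj.
pose G (c : 'I_d -> K) (b : K) :=
  exists x, j x = \sum_i c i *: e i /\ a x = b.
have [g [l [g0 lG]]] : exists g (l : 'I_d -> K), g != 0 /\
    forall c b, G c b -> g * b = \sum_i l i * c i.
  apply: domain_extend_graph => [u v c c' b b' [x [jx <-]] [y [jy <-]]
                                |b [x [jx <-]]].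
    exists (u *: x + v *: y); rewrite !linearD !linearZ /= jx jy; split=> //.
    rewrite 2!scaler_sumr -big_split; apply: eq_bigr => i _ /=.
    by rewrite !scalerA scalerDl.
  have -> : x = 0; last exact: linear0.
  apply: j_inj; rewrite jx linear0 big1 // => i _; exact: scale0r.
pose c (x : N) := projT1 (cid (eN x)).
have cE x : x = \sum_i c x i *: e i by rewrite /c; case: cid.
pose f (x : N) : K^o := \sum_i l i * c x i.
(* The value does not depend on the coordinates: relations between the
   generators lie in the graph, with value 0. *)
have fE x (c' : 'I_d -> K) : x = \sum_i c' i *: e i -> f x = \sum_i l i * c' i.
  move=> c'E; apply/subr0_eq; rewrite /f -sumrB.
  transitivity (\sum_i l i * (c x i - c' i)).
    by apply: eq_bigr => i _; rewrite mulrBr.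
  rewrite -(lG _ 0) ?mulr0 //; exists 0; rewrite !linear0; split=> //.
  under eq_bigr do rewrite scalerBl.
  by rewrite sumrB -cE -c'E subrr.
have f_zmod : zmod_morphism f.
  move=> x y; rewrite (@fE _ (fun i => c x i - c y i)).
    by rewrite /f -sumrB; apply: eq_bigr => i _; rewrite mulrBr.
  under eq_bigr do rewrite scalerBl.
  by rewrite sumrB -!cE.
have f_scal : scalable f.
  move=> b x; rewrite (@fE _ (fun i => b * c x i)).
    by rewrite [RHS]mulr_sumr; apply: eq_bigr => i _; rewrite mulrCA.
  by rewrite {1}(cE x) scaler_sumr; apply: eq_bigr => i _; rewrite scalerA.
pose fZ := GRing.isZmodMorphism.Build _ _ f f_zmod.
pose fS := GRing.isScalable.Build _ _ _ _ f f_scal.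
pose fL : {linear N -> K^o} := HB.pack f fZ fS.
exists g, fL; split=> // x.
by rewrite (lG (c (j x)) (a x)) //; exists x.
Qed.

End Domain.

(** * Periods of subquotients *)

Section Periods.

Variables (p : nat) (p_pr : prime p) (B : comNzRingType).
Variables (T0 T1 : enlargement p B) (f : ehom T0 T1) (h : ehom T1 T1).
Hypothesis dom0 : GRing.integral_domain_axiom (eringQ T0).

(** In the application h restricts to the origin of a disc and f embeds the disc
    into the line; this is then the first coordinate, in the basis transported
    along f, of the flat section of the extension with value (0, 1) at the
    origin. *)
Definition lext_period (s : forall T : enlargement p B, ering T) : eringQ T1 :=
  eloc T1 (lacunary_cocycle p (ehom_fun h (s T1)) (ehom_fun f (s T0))).

(** Linear functionals on N(T0) extend to N(T1), and linear functionals on N(T1)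
    are determined by their values on N(T0): both from the universal property
    of base change, with values in the free module of rank one. *)
Lemma base_change_functional (N : isocrystal p B)
    (l : {linear iev N T0 -> (eringQ T0)^o}) :
  exists k : {linear iev N T1 -> (eringQ T1)^o},
    forall x, k (itr N f x) = ehomQ f (l x).
Proof.
pose fl (x : iev N T0) : (eringQ T1)^o := ehomQ f (l x).
have fl_zmod : zmod_morphism fl by move=> x y; rewrite /fl !raddfB.
have fl_scal : scalable_for (ehomQ f \; *:%R) fl.
  by move=> a x; rewrite /fl linearZ /= (rmorphM (ehomQ f)).
pose flZ := GRing.isZmodMorphism.Build _ _ fl fl_zmod.
pose flS := GRing.isScalable.Build _ _ _ _ fl fl_scal.
pose flL : {linear iev N T0 -> (eringQ T1)^o | ehomQ f \; *:%R} :=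
  HB.pack fl flZ flS.
by have [k [kE _]] := itr_base_change flL; exists k.
Qed.

Lemma base_change_uniq (N : isocrystal p B)
    (k k' : {linear iev N T1 -> (eringQ T1)^o}) :
  (forall x, k (itr N f x) = k' (itr N f x)) -> k =1 k'.
Proof.
move=> kk'.
pose fl (x : iev N T0) : (eringQ T1)^o := k (itr N f x).
have fl_zmod : zmod_morphism fl by move=> x y; rewrite /fl !raddfB.
have fl_scal : scalable_for (ehomQ f \; *:%R) fl.
  by move=> a x; rewrite /fl !linearZ.
pose flZ := GRing.isZmodMorphism.Build _ _ fl fl_zmod.
pose flS := GRing.isScalable.Build _ _ _ _ fl fl_scal.
pose flL : {linear iev N T0 -> (eringQ T1)^o | ehomQ f \; *:%R} :=
  HB.pack fl flZ flS.
have [k0 [_ k0E]] := itr_base_change flL.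
by move=> x; rewrite (k0E k) // (k0E k') // => y; rewrite -kk'.
Qed.

(** The functional l extends, up to the factor g, the first coordinate on the
    subobject P of N that surjects onto the extension, and w in P lifts the
    vector (0, 1). *)
Lemma lext_period_coefficient (e : B) s (s_lift : lifting e s)
    (N : isocrystal p B) :
  subquotient (lext p_pr s_lift) N ->
  exists (g : eringQ T0) (l : {linear iev N T0 -> (eringQ T0)^o})
         (w : iev N T1),
    g != 0 /\
    forall k : {linear iev N T1 -> (eringQ T1)^o},
      (forall x, k (itr N f x) = ehomQ f (l x)) ->
      k (itr N h w) = ehomQ f g * lext_period s.
Proof.
move=> [P [j [q [j_inj q_surj]]]]; pose E := lext p_pr s_lift.
pose fst_E T (x : iev E T) : (eringQ T)^o := x.1.
pose snd_E T (x : iev E T) : (eringQ T)^o := x.2.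
pose a1 T x := fst_E T (ihom q T x).
have a1_zmod T : zmod_morphism (a1 T) by move=> x y; rewrite /a1 linearB.
have a1_scal T : scalable (a1 T) by move=> c x; rewrite /a1 linearZ.
pose aZ T := GRing.isZmodMorphism.Build _ _ (a1 T) (a1_zmod T).
pose aS T := GRing.isScalable.Build _ _ _ _ (a1 T) (a1_scal T).
pose a T : {linear iev P T -> (eringQ T)^o} := HB.pack (a1 T) (aZ T) (aS T).
have [g [l [g0 lE]]] := domain_extend dom0 (a T0) (iev_fg N T0) (j_inj T0).
have [w wE] := q_surj T1 ((0, 1) : iev E T1).
exists g, l, (ihom j T1 w); split=> // k kE.
pose c := lext_cocycle s f.
(* The functional that k must restrict to on P, up to the factor g: the first
   coordinate corrected so that it is compatible with the transition map f. *)
pose b1 (x : iev P T1) : (eringQ T1)^o :=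
  ehomQ f g * (fst_E T1 (ihom q T1 x) - c * snd_E T1 (ihom q T1 x)).
have b1_zmod : zmod_morphism b1.
  by move=> x y; rewrite /b1 linearB -mulrBr /fst_E /snd_E /=; ring.
have b1_scal : scalable b1.
  move=> d x; rewrite /b1 linearZ /fst_E /snd_E /= /GRing.scale /=; ring.
pose bZ := GRing.isZmodMorphism.Build _ _ b1 b1_zmod.
pose bS := GRing.isScalable.Build _ _ _ _ b1 b1_scal.
pose b : {linear iev P T1 -> (eringQ T1)^o} := HB.pack b1 bZ bS.
have kj : (k \o ihom j T1) =1 b.
  apply: base_change_uniq => x.
  rewrite /= ihom_nat kE lE rmorphM /b1 ihom_nat lext_trE /fst_E /snd_E /=.
  by rewrite -/c addrK.
rewrite -ihom_nat -[LHS]/((k \o ihom j T1) _) kj /= /b1 ihom_nat wE.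
rewrite lext_trE /fst_E /snd_E /= rmorph0 rmorph1 add0r !mulr1.
rewrite /lext_period /c /lext_cocycle -rmorphB; congr (_ * eloc _ _).
have sep := @ering_separated _ _ T1; have cpl := @ering_complete _ _ T1.
rewrite (@lacunary_cocycle_trans p _ p_pr sep cpl _ (ehom_fun f (s T0)) (s T1)).
- by rewrite addrK.
- apply: padic_near_trans => //; first exact: (lifting_near s_lift h).
  by apply: padic_near_sym; apply: (lifting_near s_lift f).
- exact: (lifting_near s_lift f).
Qed.

(** Any sufficiently long sequence of extensions that are subquotients of one
    isocrystal N has linearly dependent periods: each period is a coefficient
    of the parallel transport of N, that is, the value of a bilinear form on a
    pair consisting of a functional on N(T0) and a vector of the fibre of N,
    and these pairs vary in a module of finite rank. The map D expresses that
    h factors through constants, which f does not see. *)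
Lemma lext_period_relation (N : isocrystal p B)
    (D : {rmorphism eringQ T1 -> eringQ T0}) (e : nat -> B)
    (s : nat -> forall T : enlargement p B, ering T)
    (s_lift : forall n, lifting (e n) (s n)) :
  (forall c, ehomQ f (D c) = ehomQ h c) ->
  (forall n, subquotient (lext p_pr (s_lift n)) N) ->
  exists r (u : 'I_r -> eringQ T0), (exists n, u n != 0) /\
    \sum_n ehomQ f (u n) * lext_period (s n) = 0.
Proof.
move=> DE sub.
have [d0 [e0 e0E]] := iev_fg N T0; have [d1 [e1 e1E]] := iev_fg N T1.
have [g gE] := choice (fun n => lext_period_coefficient (sub n)).
have [l lE] := choice gE; have [w wE] := choice lE.
have g0 n : g n != 0 by case: (wE n).
have [k kE] := choice (fun n => base_change_functional (l n)).
have [c cE] := choice (fun n => e1E (w n)).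
pose m := #|{: 'I_d0 * 'I_d1}|.
pose a (n : 'I_m.+1) (i : 'I_m) : eringQ T0 :=
  (l n (e0 (enum_val i).1) : eringQ T0) * D (c n (enum_val i).2).
have [u [[n un] uE]] := domain_dependent dom0 a (leqnn _).
exists m.+1, (fun n => u n * g n); split.
  by exists n; apply: domain_mul_neq0.
transitivity (\sum_n ehomQ f (u n) * (k n (itr N h (w n)) : eringQ T1)).
  by apply: eq_bigr => i _; rewrite rmorphM -mulrA (proj2 (wE i) _ (kE i)).
transitivity (\sum_(j < d1) \sum_n
    ehomQ f (u n * D (c n j)) * (k n (itr N h (e1 j)) : eringQ T1)).
  rewrite exchange_big; apply: eq_bigr => i _ /=.
  rewrite {1}(cE i) !linear_sum /= mulr_sumr; apply: eq_bigr => j _.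
  by rewrite !linearZ /= rmorphM DE mulrA.
rewrite big1 // => j _.
(* This combination of the k n extends the same combination of the l n, which
   vanishes on the generators e0. *)
pose K y : (eringQ T1)^o :=
  \sum_n ehomQ f (u n * D (c n j)) * (k n y : eringQ T1).
have K_zmod : zmod_morphism K.
  move=> x y; rewrite /K -sumrB; apply: eq_bigr => i _.
  by rewrite linearB -mulrBr.
have K_scal : scalable K.
  move=> b x; rewrite /K [RHS]mulr_sumr; apply: eq_bigr => i _.
  by rewrite linearZ mulrCA.
pose KZ := GRing.isZmodMorphism.Build _ _ K K_zmod.
pose KS := GRing.isScalable.Build _ _ _ _ K K_scal.
pose KL : {linear iev N T1 -> (eringQ T1)^o} := HB.pack K KZ KS.
have K0 : KL =1 \0.
  apply: base_change_uniq => x; rewrite /= /K.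
  under eq_bigr do rewrite kE -rmorphM.
  rewrite -rmorph_sum /=; have [b bE] := e0E x.
  transitivity (ehomQ f 0); last exact: rmorph0.
  congr (ehomQ f _); rewrite bE.
  transitivity (\sum_(i < d0) b i * \sum_n u n * a n (enum_rank (i, j))).
    under [RHS]eq_bigr do rewrite mulr_sumr.
    rewrite exchange_big; apply: eq_bigr => n' _.
    rewrite linear_sum mulr_sumr; apply: eq_bigr => i _.
    by rewrite linearZ /a enum_rankK /= /GRing.scale /=; ring.
  by rewrite big1 // => i _; rewrite uE mulr0.
exact: (K0 (itr N h (e1 j))).
Qed.

End Periods.

(** * The Tate algebra Z_p<t> *)

Lemma pdvd_polyP (p k : nat) (f : {poly int}) :
  pdvd p k f <-> forall i, ((p ^ k)%N %| f`_i)%Z.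
Proof.
have pkE : (p%:R ^+ k : {poly int}) = ((p ^ k)%N%:Z)%:P.
  by rewrite -natrX -polyC_natr natz.
split=> [[g ->] i|h]; first by rewrite pkE coefCM dvdz_mulr.
exists (\poly_(i < size f) (f`_i %/ (p ^ k)%N)%Z); apply/polyP => i.
rewrite pkE coefCM coef_poly; case: ltnP => [_|hi]; last by rewrite nth_default ?mulr0.
by rewrite mulrC divzK.
Qed.

Lemma comp_poly_scaleX (R : comNzRingType) (c : R) (f : {poly R}) i :
  (f \Po (c *: 'X))`_i = c ^+ i * f`_i.
Proof.
rewrite comp_polyE (eq_bigr (fun k : 'I_(size f) => (f`_k * c ^+ k) *: 'X^k)).
  rewrite -(poly_def _ (fun k => f`_k * c ^+ k)) coef_poly.
  case: ltnP => [_|hi]; first by rewrite mulrC.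
  by rewrite nth_default // mulr0.
by move=> k _; rewrite exprZn scalerA.
Qed.

Section Reduction.

Variable p : nat.
Implicit Types (f g : {poly int}) (k : nat).

(** A normal form for congruence modulo p^k, so that coherent sequences of classes
    can be compared with Leibniz equality. *)
Definition pred_mod k f := choose (fun g => `[< pdvd p k (f - g) >]) f.

Lemma pred_mod_pdvd k f : pdvd p k (f - pred_mod k f).
Proof.
apply/asboolP; rewrite /pred_mod.
apply: (@chooseP _ (fun g => `[< pdvd p k (f - g) >]) f).
by apply/asboolP; rewrite subrr; apply: pdvd0.
Qed.

Lemma pred_mod_eq k f g : pdvd p k (f - g) -> pred_mod k f = pred_mod k g.
Proof.
move=> fg; rewrite /pred_mod.
rewrite (_ : (fun h => _) = (fun h => `[< pdvd p k (g - h) >])).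
  apply: choose_id; apply/asboolP; last by rewrite subrr; apply: pdvd0.
  exact: pdvd_sym.
apply/funext => h; apply/asbool_equiv_eq; split; apply: pdvd_trans => //.
exact: pdvd_sym.
Qed.

End Reduction.

(** Z_p<t> as the limit of the rings Z[t] / p^k, each class being given by its
    normal form. *)
Record tate (p : nat) (p_pr : prime p) := Tate {
  tval : nat -> {poly int};
  tvalP : forall k, tval k = pred_mod p k (tval k.+1)
}.

Section Tate.

Variables (p : nat) (p_pr : prime p).
Local Notation R := (tate p_pr).
Implicit Types (x y z : R) (u v : nat -> {poly int}) (k : nat).

HB.instance Definition _ := gen_eqMixin R.
HB.instance Definition _ := gen_choiceMixin R.

Definition tate_coherent u := forall k, pdvd p k (u k.+1 - u k).

Lemma tval_coherent x : tate_coherent (tval x).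
Proof. by move=> k; rewrite [tval x k]tvalP; apply: pred_mod_pdvd. Qed.

Lemma tval_le x j k : (j <= k)%N -> pdvd p j (tval x k - tval x j).
Proof.
elim: k => [|k IH]; first by case: j => // _; apply: pdvd_0.
rewrite leq_eqVlt => /orP[/eqP<-|jk]; first by rewrite subrr; apply: pdvd0.
rewrite ltnS in jk.
exact: pdvd_trans (pdvd_le jk (tval_coherent x k)) (IH jk).
Qed.

Lemma tate_eqP x y : (forall k, pdvd p k (tval x k - tval y k)) -> x = y.
Proof.
move=> xy; have E : tval x = tval y.
  apply/funext => k; rewrite [LHS]tvalP [RHS]tvalP.
  exact/pred_mod_eq/(pdvd_le (leqnSn k)).
case: x y E {xy} => [u uP] [v vP] /= E; rewrite E in uP *.
by congr Tate; apply: Prop_irrelevance.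
Qed.

Lemma tate_of_subproof u (hu : tate_coherent u) k :
  pred_mod p k (u k) = pred_mod p k (pred_mod p k.+1 (u k.+1)).
Proof.
apply: pred_mod_eq; apply: pdvd_trans (pdvd_le (leqnSn k) (pred_mod_pdvd _ _ _)).
exact/pdvd_sym/hu.
Qed.

Definition tate_of u (hu : tate_coherent u) : R := Tate p_pr (tate_of_subproof hu).

(** u represents x in the limit of the rings Z[t] / p^k. Identities between
    elements are checked on representing sequences, where they are identities
    in Z[t]. *)
Definition tate_rep x u := forall k, pdvd p k (tval x k - u k).

Lemma tate_rep_tval x : tate_rep x (tval x).
Proof. by move=> k; rewrite subrr; apply: pdvd0. Qed.

Lemma tate_rep_of u (hu : tate_coherent u) : tate_rep (tate_of hu) u.
Proof. by move=> k; apply/pdvd_sym/pred_mod_pdvd. Qed.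

Lemma tate_rep_eq x y u v : tate_rep x u -> tate_rep y v -> u =1 v -> x = y.
Proof.
move=> hx hy uv; apply: tate_eqP => k; apply: pdvd_trans (hx k) _.
by rewrite uv; apply/pdvd_sym/hy.
Qed.

Fact coherentD u v : tate_coherent u -> tate_coherent v ->
  tate_coherent (fun k => u k + v k).
Proof. by move=> hu hv k; have := pdvdD (hu k) (hv k); congr pdvd; ring. Qed.

Fact coherentM u v : tate_coherent u -> tate_coherent v ->
  tate_coherent (fun k => u k * v k).
Proof.
move=> hu hv k.
have := pdvdD (pdvdMr (v k.+1) (hu k)) (pdvdMl (u k) (hv k)).
by congr pdvd; ring.
Qed.

Fact coherentN u : tate_coherent u -> tate_coherent (fun k => - u k).
Proof. by move=> hu k; have := pdvdN (hu k); congr pdvd; ring. Qed.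

Fact coherent_cst f : tate_coherent (fun=> f).
Proof. by move=> k; rewrite subrr; apply: pdvd0. Qed.

Definition tate_add x y :=
  tate_of (coherentD (tval_coherent x) (tval_coherent y)).
Definition tate_mul x y :=
  tate_of (coherentM (tval_coherent x) (tval_coherent y)).
Definition tate_opp x := tate_of (coherentN (tval_coherent x)).
Definition tate_cst f := tate_of (coherent_cst f).

Lemma tate_rep_add x y u v : tate_rep x u -> tate_rep y v ->
  tate_rep (tate_add x y) (fun k => u k + v k).
Proof.
move=> hx hy k; apply: pdvd_trans (tate_rep_of _ k) _.
by have := pdvdD (hx k) (hy k); congr pdvd; ring.
Qed.

Lemma tate_rep_mul x y u v : tate_rep x u -> tate_rep y v ->
  tate_rep (tate_mul x y) (fun k => u k * v k).
Proof.
move=> hx hy k; apply: pdvd_trans (tate_rep_of _ k) _.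
have := pdvdD (pdvdMr (tval y k) (hx k)) (pdvdMl (u k) (hy k)).
by congr pdvd; ring.
Qed.

Lemma tate_rep_opp x u : tate_rep x u -> tate_rep (tate_opp x) (fun k => - u k).
Proof.
move=> hx k; apply: pdvd_trans (tate_rep_of _ k) _.
by have := pdvdN (hx k); congr pdvd; ring.
Qed.

Lemma tate_rep_cst f : tate_rep (tate_cst f) (fun=> f).
Proof. exact: tate_rep_of. Qed.

Local Ltac tate_law := repeat move=> ?; eapply tate_rep_eq;
  [ repeat (apply: tate_rep_add || apply: tate_rep_mul || apply: tate_rep_opp
            || apply: tate_rep_cst || apply: tate_rep_tval) ..
  | move=> k /=; ring ].

Fact tate_addA : associative tate_add. Proof. tate_law. Qed.
Fact tate_addC : commutative tate_add. Proof. tate_law. Qed.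
Fact tate_add0 : left_id (tate_cst 0) tate_add. Proof. tate_law. Qed.
Fact tate_addN : left_inverse (tate_cst 0) tate_opp tate_add.
Proof. tate_law. Qed.
Fact tate_mulA : associative tate_mul. Proof. tate_law. Qed.
Fact tate_mulC : commutative tate_mul. Proof. tate_law. Qed.
Fact tate_mul1 : left_id (tate_cst 1) tate_mul. Proof. tate_law. Qed.
Fact tate_mulD : left_distributive tate_mul tate_add. Proof. tate_law. Qed.

HB.instance Definition _ :=
  GRing.isZmodule.Build R tate_addA tate_addC tate_add0 tate_addN.

Fact tate_1_neq0 : tate_cst 1 != 0.
Proof.
apply/eqP => E; have := tate_rep_cst 1 1; rewrite E.
move=> /pdvd_sym h; have := pdvdD h (tate_rep_cst 0 1).
rewrite subr0 subrK => /pdvd_polyP/(_ 0%N); rewrite coef1 expn1 /=.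
by rewrite dvdzE /= dvdn1 => /eqP p1; have := p_pr; rewrite p1.
Qed.

HB.instance Definition _ := GRing.Zmodule_isComNzRing.Build R
  tate_mulA tate_mulC tate_mul1 tate_mulD tate_1_neq0.

Lemma tate_repD x y u v : tate_rep x u -> tate_rep y v ->
  tate_rep (x + y) (fun k => u k + v k).
Proof. exact: tate_rep_add. Qed.

Lemma tate_repM x y u v : tate_rep x u -> tate_rep y v ->
  tate_rep (x * y) (fun k => u k * v k).
Proof. exact: tate_rep_mul. Qed.

Lemma tate_repN x u : tate_rep x u -> tate_rep (- x) (fun k => - u k).
Proof. exact: tate_rep_opp. Qed.

Lemma tate_repB x y u v : tate_rep x u -> tate_rep y v ->
  tate_rep (x - y) (fun k => u k - v k).
Proof. by move=> hx hy; apply: tate_repD hx (tate_repN hy). Qed.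

Fact tate_cst_zmod : zmod_morphism tate_cst.
Proof.
by move=> f g; apply: (tate_rep_eq (tate_rep_cst _)
  (tate_repB (tate_rep_cst f) (tate_rep_cst g))).
Qed.

Fact tate_cst_monoid : monoid_morphism tate_cst.
Proof.
by split=> // f g; apply: (tate_rep_eq (tate_rep_cst _)
  (tate_repM (tate_rep_cst f) (tate_rep_cst g))).
Qed.

HB.instance Definition _ :=
  GRing.isZmodMorphism.Build {poly int} R tate_cst tate_cst_zmod.
HB.instance Definition _ :=
  GRing.isMonoidMorphism.Build {poly int} R tate_cst tate_cst_monoid.

Lemma tate_rep_pexpM j x u :
  tate_rep x u -> tate_rep (p%:R ^+ j * x) (fun k => p%:R ^+ j * u k).
Proof.
move=> hx; rewrite -(rmorph_nat tate_cst) -rmorphXn.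
exact: tate_repM (tate_rep_cst _) hx.
Qed.

Lemma poly_int_torsion_free : p_torsion_free p {poly int}.
Proof.
move=> f /eqP; rewrite mulf_eq0 => /orP[|/eqP//].
by rewrite -polyC_natr polyC_eq0 natz eqz_nat -leqn0 leqNgt prime_gt0.
Qed.

(** Z[t] being torsion-free, the quotients by p^k of the terms of a coherent
    sequence are coherent again. *)
Lemma tate_pdvdP k x : pdvd p k x <-> pdvd p k (tval x k).
Proof.
split=> [[y ->]|hx].
  have [c E] := tate_rep_pexpM k (tate_rep_tval y) k.
  rewrite (_ : tval _ k = p%:R ^+ k * (c + tval y k)).
    by exists (c + tval y k).
  by rewrite mulrDr -E subrK.
have hz n : pdvd p k (tval x (n + k)).
  rewrite -[tval x _](subrK (tval x k)); apply: pdvdD hx.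
  exact/tval_le/leq_addl.
have [z zE] := choice hz.
have z_coh : tate_coherent z.
  move=> n; have [c cE] := tval_coherent x (n + k); exists c.
  apply: (pdvd_regl (k := k) poly_int_torsion_free).
  rewrite mulrBr -!zE addSn cE [in RHS]mulrA; congr (_ * _).
  by rewrite exprD mulrC.
exists (tate_of z_coh).
apply: (tate_rep_eq (u := fun n => tval x (n + k)))
  (tate_rep_pexpM k (tate_rep_of z_coh)) _ => // n.
exact/pdvd_sym/tval_le/leq_addr.
Qed.

Lemma tate_separated : padic_separated p R.
Proof.
move=> x hx; apply: tate_eqP => k.
have h0 : pdvd p k (tval (0 : R) k) by apply/tate_pdvdP/pdvd0.
by apply: pdvdB h0; apply/tate_pdvdP.
Qed.

Lemma tate_complete : padic_complete p R.
Proof.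
move=> u hu; have l_coh : tate_coherent (fun k => tval (u k) k).
  move=> k; apply: pdvd_trans (tval_coherent (u k.+1) k) _.
  have /tate_pdvdP h := hu k.
  have := pdvdB h (tate_repB (tate_rep_tval (u k.+1)) (tate_rep_tval (u k)) k).
  by congr pdvd; ring.
exists (tate_of l_coh) => k; apply/tate_pdvdP.
have := tate_repB (tate_rep_of l_coh) (tate_rep_tval (u k)) k.
by congr pdvd; ring.
Qed.

Lemma tate_torsion_free : p_torsion_free p R.
Proof.
move=> x px; apply: tate_separated => k; apply/tate_pdvdP.
have := tate_rep_pexpM 1 (tate_rep_tval x) k.+1; rewrite expr1 px => h.
have h0 : pdvd p k.+1 (tval (0 : R) k.+1) by apply/tate_pdvdP/pdvd0.
have [c cE] : pdvd p k.+1 (p%:R ^+ 1 * tval x k.+1).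
  by have := pdvdB h0 h; congr pdvd; ring.
have xk : pdvd p k (tval x k.+1).
  exists c; apply: (pdvd_regl (k := 1) poly_int_torsion_free).
  by rewrite cE exprS expr1 mulrA.
by have := pdvdB xk (tval_coherent x k); congr pdvd; ring.
Qed.

(** ** Reduction modulo p *)

Definition poly_mod_p : {poly int} -> {poly 'F_p} :=
  map_poly (intr : int -> 'F_p).
HB.instance Definition _ := GRing.RMorphism.on poly_mod_p.

Lemma poly_mod_p_eq0 (f : {poly int}) : poly_mod_p f = 0 <-> pdvd p 1 f.
Proof.
have dvdE i : (p %| f`_i)%Z = ((poly_mod_p f)`_i == 0).
  by rewrite coef_map (dvdz_pcharf (pchar_Fp p_pr)).
split=> [f0|/pdvd_polyP h].
  by apply/pdvd_polyP => i; rewrite expn1 dvdE f0 coef0.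
by apply/polyP => i; apply/eqP; rewrite coef0 -dvdE -[p]expn1.
Qed.

Definition tate_mod x : {poly 'F_p} := poly_mod_p (tval x 1).

Lemma tate_modE x u : tate_rep x u -> tate_mod x = poly_mod_p (u 1%N).
Proof.
move=> /(_ 1%N)/poly_mod_p_eq0 E; apply/subr0_eq.
by rewrite /tate_mod -rmorphB.
Qed.

Fact tate_mod_zmod : zmod_morphism tate_mod.
Proof.
move=> x y; rewrite (tate_modE (tate_repB (tate_rep_tval x) (tate_rep_tval y))).
exact: rmorphB.
Qed.

Lemma tate_mod_cst f : tate_mod (tate_cst f) = poly_mod_p f.
Proof. exact: tate_modE (tate_rep_cst f). Qed.

Fact tate_mod_monoid : monoid_morphism tate_mod.
Proof.
split=> [|x y]; first by rewrite -[1](rmorph1 tate_cst) tate_mod_cst rmorph1.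
rewrite (tate_modE (tate_repM (tate_rep_tval x) (tate_rep_tval y))).
exact: rmorphM.
Qed.

HB.instance Definition _ :=
  GRing.isZmodMorphism.Build R {poly 'F_p} tate_mod tate_mod_zmod.
HB.instance Definition _ :=
  GRing.isMonoidMorphism.Build R {poly 'F_p} tate_mod tate_mod_monoid.

Lemma tate_mod_eq0 x : tate_mod x = 0 <-> pdvd p 1 x.
Proof. by rewrite poly_mod_p_eq0 tate_pdvdP. Qed.

Lemma tate_mod_surj f : exists x, tate_mod x = f.
Proof.
exists (tate_cst (\poly_(i < size f) (val f`_i)%:Z)); rewrite tate_mod_cst.
apply/polyP => i; rewrite coef_map coef_poly.
case: ltnP => [_|hi]; last by rewrite nth_default.
exact: natr_Zp.
Qed.

Lemma tate_mod_ker x : tate_mod x = 0 <-> exists n, pdvd p 1 (x ^+ n).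
Proof.
split=> [/tate_mod_eq0 h|[n /tate_mod_eq0]]; first by exists 1%N.
by rewrite rmorphXn => /eqP; rewrite expf_eq0 => /andP[_ /eqP].
Qed.

(** Modulo p, the ring is generated by t. *)
Lemma tate_finite_type : finite_type_mod_p p R.
Proof.
exists 1%N, (fun=> tate_cst 'X) => S [S1 SB SM] /(_ ord0) SX Sp x.
have S0 : S 0 by rewrite -(subrr 1); apply: SB.
have SD y z : S y -> S z -> S (y + z).
  by move=> hy hz; rewrite -[z]opprK -[- z]sub0r; apply/SB/SB.
have Sn n : S n%:R.
  by elim: n => [//|n IH]; rewrite -addn1 natrD; apply: SD.
have Sz (m : int) : S m%:~R.
  case: m => n; first exact: Sn.
  by rewrite -[_%:~R]/(- n.+1%:R) -sub0r; apply/SB/Sn.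
have Sf (f : {poly int}) : S (tate_cst f).
  elim/poly_ind: f => [|f c IH]; first by rewrite rmorph0.
  rewrite rmorphD rmorphM; apply: SD; first exact: SM.
  by rewrite -[c]intz (rmorph_int (@polyC int)) rmorph_int.
rewrite -[x](subrK (tate_cst (tval x 1))); apply: SD (Sf _).
by apply/Sp/tate_mod_eq0; rewrite rmorphB /= tate_mod_cst; apply: subrr.
Qed.

Lemma tate_primitive_part (I : Type) (x : I -> R) : (exists i, x i != 0) ->
  exists k (y : I -> R), (forall i, x i = p%:R ^+ k * y i) /\
    exists i, tate_mod (y i) != 0.
Proof.
move=> [i0 x0]; apply: contrapT => /forallNP h.
have xk k : exists y : I -> R, forall i, x i = p%:R ^+ k * y i.
  elim: k => [|k [y yE]]; first by exists x => i; rewrite mul1r.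
  have y0 i : exists z, y i = p%:R * z.
    have [/tate_mod_eq0|y0] := eqVneq (tate_mod (y i)) 0; first by rewrite /pdvd expr1.
    by case: (h k); exists y; split=> //; exists i.
  have [z zE] := choice y0; exists z => i.
  by rewrite yE zE exprSr mulrA.
move/eqP: x0; apply; apply: tate_separated => k.
by have [y yE] := xk k; exists (y i0).
Qed.

(** The product of two primitive elements is primitive because F_p[t] is a
    domain. *)
Lemma tate_domain : GRing.integral_domain_axiom R.
Proof.
have factor x : x != 0 -> exists k y, x = p%:R ^+ k * y /\ tate_mod y != 0.
  move=> x0; have [|k [y [yE [[] y0]]]] := @tate_primitive_part unit (fun=> x).
    by exists tt.
  by exists k, (y tt).
move=> x y xy; apply: contrapT => /negP/norP[/factor[k [x' [xE x0]]]].
move=> /factor[j [y' [yE y0]]].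
have := mulf_neq0 x0 y0; rewrite -rmorphM (_ : x' * y' = 0) ?rmorph0 ?eqxx //.
apply: (pdvd_regl (k := k + j) tate_torsion_free).
by rewrite exprD mulrACA -xE -yE xy mulr0.
Qed.

(** ** Endomorphisms *)

Section Lift.

Variable F : {rmorphism {poly int} -> {poly int}}.

Fact tate_lift_coherent u : tate_coherent u -> tate_coherent (F \o u).
Proof. by move=> hu k; rewrite -rmorphB; apply/pdvd_morph/hu. Qed.

Definition tate_lift x := tate_of (tate_lift_coherent (tval_coherent x)).

Lemma tate_rep_lift x u : tate_rep x u -> tate_rep (tate_lift x) (F \o u).
Proof.
move=> hx k; apply: pdvd_trans (tate_rep_of _ k) _.
by rewrite /= -rmorphB; apply/pdvd_morph/hx.
Qed.

Fact tate_lift_zmod : zmod_morphism tate_lift.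
Proof.
move=> x y; have [hx hy] := (tate_rep_tval x, tate_rep_tval y).
apply: (tate_rep_eq (tate_rep_lift (tate_repB hx hy))).
  exact: tate_repB (tate_rep_lift hx) (tate_rep_lift hy).
by move=> k /=; rewrite rmorphB.
Qed.

Lemma tate_lift_cst f : tate_lift (tate_cst f) = tate_cst (F f).
Proof.
by apply: (tate_rep_eq (tate_rep_lift (tate_rep_cst f)) (tate_rep_cst _)).
Qed.

Fact tate_lift_monoid : monoid_morphism tate_lift.
Proof.
split=> [|x y].
  by rewrite -[1](rmorph1 tate_cst) tate_lift_cst (rmorph1 F).
have [hx hy] := (tate_rep_tval x, tate_rep_tval y).
apply: (tate_rep_eq (tate_rep_lift (tate_repM hx hy))).
  exact: tate_repM (tate_rep_lift hx) (tate_rep_lift hy).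
by move=> k /=; rewrite rmorphM.
Qed.

HB.instance Definition _ :=
  GRing.isZmodMorphism.Build R R tate_lift tate_lift_zmod.
HB.instance Definition _ :=
  GRing.isMonoidMorphism.Build R R tate_lift tate_lift_monoid.

End Lift.

(** The map t |-> p t contracts the disc into a residue disc, and t |-> 0 further
    to its centre. *)
Definition tate_contract : {rmorphism R -> R} :=
  tate_lift (comp_poly (p%:R *: 'X)).
Definition tate_at0 : {rmorphism R -> R} := tate_lift (comp_poly 0).

Lemma tate_contract_at0 x : tate_contract (tate_at0 x) = tate_at0 x.
Proof.
apply: (tate_rep_eq (tate_rep_lift _ (tate_rep_lift _ (tate_rep_tval x)))
  (tate_rep_lift _ (tate_rep_tval x))) => k.
by rewrite /= !comp_poly0r comp_polyC.
Qed.

Lemma tate_mod_contract x : tate_mod (tate_contract x) = tate_mod x \Po 0.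
Proof.
rewrite (tate_modE (tate_rep_lift _ (tate_rep_tval x))) /=.
by rewrite /poly_mod_p map_comp_poly map_polyZ rmorph_nat pchar_Fp_0 // scale0r.
Qed.

Lemma tate_mod_at0 x : tate_mod (tate_at0 x) = tate_mod x \Po 0.
Proof.
rewrite (tate_modE (tate_rep_lift _ (tate_rep_tval x))) /=.
by rewrite /poly_mod_p map_comp_poly rmorph0.
Qed.

(** The contraction multiplies the coefficient of t^i by p^i, so that a highly
    divisible image has no low-degree terms modulo p. *)
Lemma tate_contract_pdvd L x : pdvd p L (tate_contract x) ->
  forall i, (i < L)%N -> (tate_mod x)`_i = 0.
Proof.
move=> /tate_pdvdP h i iL.
have hL : pdvd p L (tval x L \Po (p%:R *: 'X)).
  have r : tate_rep (tate_contract x) (fun k => tval x k \Po (p%:R *: 'X)).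
    exact: tate_rep_lift (tate_rep_tval x).
  by have := pdvdB h (r L); rewrite subKr.
have xE : tate_mod x = poly_mod_p (tval x L).
  apply/esym/subr0_eq; rewrite /tate_mod -rmorphB; apply/poly_mod_p_eq0.
  by apply: tval_le; lia.
move/pdvd_polyP/(_ i): hL; rewrite comp_poly_scaleX -natrX natz => hi.
apply/eqP; rewrite xE coef_map -(dvdz_pcharf (pchar_Fp p_pr)).
have pi_gt0 : (0 < p ^ i)%N by rewrite expn_gt0 prime_gt0.
have : ((p ^ i * p)%N %| (p ^ i)%N%:Z * (tval x L)`_i)%Z.
  by apply: dvdz_trans hi; rewrite dvdzE /= -expnSr dvdn_exp2l.
by rewrite PoszM dvdz_mul2l // eqz_nat -lt0n.
Qed.

End Tate.

(** * Enlargements of the affine line by Z_p<t> *)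

(** The component on A[1/p] comes for free: it sends x to f(p^k x) / p^k for k
    large. *)
Lemma ehom_exists (p : nat) (B : comNzRingType) (T T' : enlargement p B)
    (f : {rmorphism ering T -> ering T'}) (f0 : {rmorphism ered T -> ered T'}) :
  (forall a, f0 (epi T a) = epi T' (f a)) ->
  (forall b, f0 (estr T b) = estr T' b) ->
  exists F : ehom T T', ehom_fun F = f.
Proof.
move=> f0_pi f0_str; have [i pi1] := eloc_p T'.
have pk1 k : p%:R ^+ k * i ^+ k = 1 by rewrite -exprMn pi1 expr1n.
have pow_inj k (y z : eringQ T') : p%:R ^+ k * y = p%:R ^+ k * z -> y = z.
  move=> /(congr1 (fun u => i ^+ k * u)).
  by rewrite !mulrA [i ^+ k * _]mulrC pk1 !mul1r.
have loc_pow (U : enlargement p B) k : eloc U (p%:R ^+ k) = p%:R ^+ k.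
  by rewrite rmorphXn rmorph_nat.
have Pn k : p%:R ^+ k = f (p%:R ^+ k) by rewrite rmorphXn rmorph_nat.
have [k kE] := choice (@eloc_frac _ _ T); have [a aE] := choice kE.
pose g x : eringQ T' := i ^+ (k x) * eloc T' (f (a x)).
have gE x n b : p%:R ^+ n * x = eloc T b -> p%:R ^+ n * g x = eloc T' (f b).
  move=> bE; apply: (pow_inj (k x)); rewrite /g mulrCA.
  rewrite [_ * (i ^+ _ * _)]mulrA pk1 mul1r.
  rewrite -!loc_pow !Pn -!rmorphM; congr (eloc T' (f _)).
  apply: (@eloc_inj _ _ T); rewrite !rmorphM -aE -bE !rmorphXn !rmorph_nat.
  by rewrite mulrCA.
have gU x y n b : p%:R ^+ n * x = eloc T b -> p%:R ^+ n * y = eloc T' (f b) ->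
    g x = y.
  by move=> /gE <- /pow_inj.
have g_zmod : zmod_morphism g.
  move=> x y; apply: (gU _ _ (k x + k y)%N
      (p%:R ^+ (k y) * a x - p%:R ^+ (k x) * a y)).
    by rewrite rmorphB !rmorphM -!aE !loc_pow exprD; ring.
  rewrite rmorphB !rmorphM rmorphB !rmorphM -(gE _ _ _ (aE x)) -(gE _ _ _ (aE y)).
  by rewrite -!Pn !loc_pow exprD; ring.
have g_mon : monoid_morphism g.
  split=> [|x y].
    by apply: (gU _ _ 0%N 1); rewrite mul1r !rmorph1.
  apply: (gU _ _ (k x + k y)%N (a x * a y)).
    by rewrite rmorphM -!aE exprD; ring.
  by rewrite !rmorphM -(gE _ _ _ (aE x)) -(gE _ _ _ (aE y)) exprD; ring.
pose gZ := GRing.isZmodMorphism.Build _ _ g g_zmod.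
pose gM := GRing.isMonoidMorphism.Build _ _ g g_mon.
pose gR : {rmorphism eringQ T -> eringQ T'} := HB.pack g gZ gM.
have gloc b : gR (eloc T b) = eloc T' (f b).
  by apply: (gU _ _ 0%N b); rewrite mul1r.
by exists (EHom gloc f0_pi f0_str).
Qed.

Section TateEnlargements.

Variables (p : nat) (p_pr : prime p).
Local Notation R := (tate p_pr).

Fact tate_mulVx : {in [pred x : R | `[< exists y, y * x = 1 >]],
  left_inverse 1 (fun x => if pselect (exists y, y * x = 1) is left ex
                           then projT1 (cid ex) else x) *%R}.
Proof.
by move=> x /asboolP h; case: pselect => // h'; case: cid.
Qed.

Fact tate_unitPl (x y : R) : y * x = 1 ->
  [pred x : R | `[< exists y, y * x = 1 >]] x.
Proof. by move=> yx; apply/asboolP; exists y. Qed.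

Fact tate_invr_out : {in [predC [pred x : R | `[< exists y, y * x = 1 >]]],
  (fun x : R => if pselect (exists y, y * x = 1) is left ex
                then projT1 (cid ex) else x) =1 id}.
Proof. by move=> x /asboolPn h; case: pselect. Qed.

HB.instance Definition _ := GRing.ComNzRing_hasMulInverse.Build R
  tate_mulVx tate_unitPl tate_invr_out.
HB.instance Definition _ :=
  GRing.ComUnitRing_isIntegral.Build R (@tate_domain p p_pr).

Local Notation tofrac := (@FracField.tofrac R).

(** Q_p<t> inside the fraction field of Z_p<t>. *)
Definition p_integral (x : {fraction R}) : bool :=
  `[< exists k (a : R), p%:R ^+ k * x = tofrac a >].

Fact p_integral_closed : subring_closed p_integral.
Proof.
split=> [|x y /asboolP[k [a aE]] /asboolP[j [b bE]]
         |x y /asboolP[k [a aE]] /asboolP[j [b bE]]]; apply/asboolP.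
- by exists 0%N, 1; rewrite mul1r rmorph1.
- exists (k + j)%N, (p%:R ^+ j * a - p%:R ^+ k * b).
  rewrite tofracB !tofracM -aE -bE !tofracXn !tofracMn !tofrac1 exprD; ring.
- by exists (k + j)%N, (a * b); rewrite tofracM -aE -bE exprD; ring.
Qed.

HB.instance Definition _ :=
  GRing.isSubringClosed.Build {fraction R} p_integral p_integral_closed.

Record tateQ := TateQ { tateQ_val :> {fraction R}; _ : tateQ_val \in p_integral }.

HB.instance Definition _ := [isSub for tateQ_val].
HB.instance Definition _ := [Choice of tateQ by <:].
HB.instance Definition _ := [SubChoice_isSubComNzRing of tateQ by <:].

Fact tateQ_loc_subproof (a : R) : tofrac a \in p_integral.
Proof. by apply/asboolP; exists 0%N, a; rewrite mul1r. Qed.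

Definition tateQ_loc (a : R) : tateQ := TateQ (tateQ_loc_subproof a).

Fact tateQ_loc_zmod : zmod_morphism tateQ_loc.
Proof. by move=> a b; apply: val_inj; rewrite /= rmorphB. Qed.

Fact tateQ_loc_monoid : monoid_morphism tateQ_loc.
Proof. by split=> [|a b]; apply: val_inj; rewrite /= ?rmorph1 ?rmorphM. Qed.

HB.instance Definition _ :=
  GRing.isZmodMorphism.Build R tateQ tateQ_loc tateQ_loc_zmod.
HB.instance Definition _ :=
  GRing.isMonoidMorphism.Build R tateQ tateQ_loc tateQ_loc_monoid.

Lemma tateQ_loc_inj : injective tateQ_loc.
Proof. by move=> a b /(congr1 val) /eqP; rewrite tofrac_eq => /eqP. Qed.

Lemma tate_p_neq0 : (p%:R : R) != 0.
Proof.
apply/eqP => p0; have /eqP := oner_neq0 R; apply.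
by apply: (@tate_torsion_free p p_pr); rewrite p0 mul0r.
Qed.

Lemma tateQ_p : exists i : tateQ, p%:R * i = 1.
Proof.
have pF : (p%:R : {fraction R}) != 0.
  by rewrite -(rmorph_nat tofrac) tofrac_eq0 tate_p_neq0.
have hi : (p%:R^-1 : {fraction R}) \in p_integral.
  by apply/asboolP; exists 1%N, 1; rewrite expr1 mulfV // rmorph1.
by exists (TateQ hi); apply: val_inj; rewrite rmorphM rmorph1 rmorph_nat /= mulfV.
Qed.

Lemma tateQ_frac (x : tateQ) : exists k a, p%:R ^+ k * x = tateQ_loc a.
Proof.
case: x => x hx; have /asboolP[k [a aE]] := hx; exists k, a.
by apply: val_inj; rewrite rmorphM rmorphXn rmorph_nat.
Qed.

Lemma tateQ_domain : GRing.integral_domain_axiom tateQ.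
Proof.
move=> x y /(congr1 val); rewrite rmorphM rmorph0 => /eqP.
by rewrite mulf_eq0 -!(inj_eq val_inj) rmorph0.
Qed.

Definition tate_enl (z : {rmorphism {poly 'F_p} -> {poly 'F_p}}) :
    enlargement p {poly 'F_p} :=
  @Enlargement p {poly 'F_p} R
    (@tate_separated p p_pr) (@tate_complete p p_pr)
    (@tate_torsion_free p p_pr) (@tate_finite_type p p_pr)
    tateQ tateQ_loc tateQ_loc_inj tateQ_p tateQ_frac
    {poly 'F_p} (@tate_mod p p_pr) (@tate_mod_surj p p_pr)
    (@tate_mod_ker p p_pr) z.

(** The affine line, and the closed disc of radius |p| around the origin with the
    coordinate t / p; modulo p this disc is mapped to the origin. *)
Definition tate_line := tate_enl idfun.
Definition tate_disc := tate_enl (comp_poly 0).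

Lemma ehom_contract : exists F : ehom tate_line tate_disc,
  ehom_fun F = tate_contract p_pr.
Proof.
apply: (@ehom_exists _ _ tate_line tate_disc _ (comp_poly 0)) => // a /=.
by rewrite tate_mod_contract.
Qed.

Lemma ehom_at0 : exists F : ehom tate_disc tate_disc,
  ehom_fun F = tate_at0 p_pr.
Proof.
apply: (@ehom_exists _ _ tate_disc tate_disc _ (comp_poly 0)) => [a|b] /=.
  by rewrite tate_mod_at0.
by rewrite !comp_poly0r coefC.
Qed.

(** The image of t |-> 0 consists of constants, which the contraction fixes. *)
Lemma tateQ_at0_factor (f : ehom tate_line tate_disc)
    (h : ehom tate_disc tate_disc) :
  ehom_fun f = tate_contract p_pr -> ehom_fun h = tate_at0 p_pr ->
  forall c, ehomQ f (ehomQ h c : tateQ) = ehomQ h c.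
Proof.
move=> fE hE c; have [i pi1] := tateQ_p; have [k [a aE]] := tateQ_frac c.
have pw (u : {rmorphism tateQ -> tateQ}) x : p%:R ^+ k * u x = u (p%:R ^+ k * x).
  by rewrite rmorphM rmorphXn rmorph_nat.
have E : p%:R ^+ k * ehomQ f (ehomQ h c : tateQ) = p%:R ^+ k * ehomQ h c.
  rewrite (pw (ehomQ f)) (pw (ehomQ h)) aE (ehomQ_loc h) (ehomQ_loc f).
  by rewrite fE hE; congr tateQ_loc; apply: tate_contract_at0.
have := congr1 (fun y => i ^+ k * y) E.
by rewrite !mulrA -exprMn [i * _]mulrC pi1 expr1n !mul1r.
Qed.

End TateEnlargements.

(** * Independence of the Frobenius translates of the lacunary series *)

Lemma lacunary_exp2 m : lacunary (2 ^ m).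
Proof. by rewrite /lacunary trunc_expnK. Qed.

Lemma lacunary_gap m k : lacunary k -> k != (2 ^ m.+1)%N ->
  (k + 2 ^ m <= 2 ^ m.+1)%N || (2 ^ m.+1 + 2 ^ m <= k)%N.
Proof.
rewrite /lacunary; move: (trunc_log 2 k) => a /eqP -> ne.
have [am|ma] := leqP a m.
  by have := leq_pexp2l (isT : (0 < 2)%N) am; rewrite expnS; lia.
have {}ma : (m.+2 <= a)%N.
  by rewrite ltn_neqAle ma andbT; apply: contra ne => /eqP <-.
by have := leq_pexp2l (isT : (0 < 2)%N) ma; rewrite !expnS; lia.
Qed.

Definition lacunary_poly (F : comNzRingType) (p n M : nat) : {poly F} :=
  \sum_(k < M | lacunary k) 'X^(p ^ (n + k)).

(** The power series F_n = sum_k t^(p^(n+k)), for n < r, are linearly independent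
    modulo polynomials: far out, near a degree p^(n0+k0) with k0 a large
    exponent of the lacunary set, F_(n0) has the only nonzero coefficient
    among all the F_n. *)
Lemma lacunary_independent (F : comNzRingType) (p r : nat) (u : 'I_r -> {poly F})
    (W : {poly F}) :
  (1 < p)%N ->
  (forall M i, (i < p ^ M)%N ->
     (\sum_n u n * lacunary_poly F p n M)`_i = W`_i) ->
  forall n, u n = 0.
Proof.
move=> p_gt1 uW n0; apply/polyP => d; rewrite coef0.
pose D := (\max_n size (u n) + size W)%N.
have uD n i : (D <= i)%N -> (u n)`_i = 0.
  move=> Di; apply: nth_default.
  apply: leq_trans Di; apply: leq_trans (leq_addr _ _).
  exact: (leq_bigmax (F := fun n => size (u n)) n).
have [/uD //|dD] := leqP D d.
(* k0 is so large that its neighbours in the lacunary set are at distance at least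
   2^m > r, and that consecutive powers of p near p^(n0+k0) are more than D
   apart. *)
pose m := (r + D)%N; pose k0 := (2 ^ m.+1)%N.
have m_lt : (m < 2 ^ m)%N by apply: ltn_expl.
have k0E : k0 = (2 * 2 ^ m)%N by rewrite /k0 expnS.
pose s := (n0 + k0)%N.
have ps : (p * p ^ s.-1 = p ^ s)%N by rewrite -expnS prednK // /s; lia.
have D_lt : (D < p ^ s.-1)%N.
  by apply: leq_ltn_trans (ltn_expl _ p_gt1); rewrite /s; lia.
pose i := (p ^ s + d)%N.
have pM : (p * p ^ s = p ^ s.+1)%N by rewrite expnS.
have i_lt : (i < p ^ s.+1)%N by rewrite /i; nia.
pose coef (n : 'I_r) k :=
  if (i < p ^ (n + k))%N then 0 else (u n)`_(i - p ^ (n + k)).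
have coefE n : (u n * lacunary_poly F p n s.+1)`_i =
    \sum_(k < s.+1 | lacunary k) coef n k.
  by rewrite mulr_sumr coef_sum; apply: eq_bigr => k _; rewrite coefMXn.
have coef_eq0 (n : 'I_r) k : lacunary k -> (n != n0) || (k != k0) -> coef n k = 0.
  move=> lk nk; rewrite /coef; case: (ltngtP (n + k) s) => [lt_s|gt_s|eq_s].
  - have : (p ^ (n + k) <= p ^ s.-1)%N by apply: leq_pexp2l; lia.
    by case: ltnP => // _ le_s; apply: uD; rewrite /i; nia.
  - have : (p ^ s.+1 <= p ^ (n + k))%N by apply: leq_pexp2l; lia.
    by move=> le_s; rewrite (leq_trans i_lt le_s).
  - have kk0 : k != k0.
      case/orP: nk => // nn0; apply: contra nn0 => /eqP kk0; apply/eqP/val_inj.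
      by move: eq_s; rewrite kk0 /s /=; lia.
    have r_m : (r <= m)%N by apply: leq_addr.
    have [n_r n0_r] := (ltn_ord n, ltn_ord n0).
    have /orP gap := lacunary_gap lk kk0; rewrite -/k0 in gap.
    have {}eq_s : (n + k = n0 + k0)%N := eq_s.
    by clear -eq_s m_lt r_m n_r n0_r gap; lia.
have k0s : (k0 < s.+1)%N by rewrite /s; lia.
have := uW _ _ i_lt; rewrite coef_sum.
have -> : W`_i = 0.
  apply: nth_default; apply: (@leq_trans D); first exact: leq_addl.
  by rewrite /i; nia.
rewrite (bigD1 n0) //= big1 => [|n nn0]; last first.
  by rewrite coefE big1 // => k lk; apply: coef_eq0; rewrite ?nn0.
rewrite addr0 coefE (bigD1 (Ordinal k0s)) /=; last exact: lacunary_exp2.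
rewrite big1 => [|k /andP[lk kk0]]; last by apply: coef_eq0; rewrite // kk0 orbT.
by rewrite addr0 /coef -/s /i addKn ltnNge leq_addr.
Qed.

Section FrobeniusPeriods.

Variables (p : nat) (p_pr : prime p).
Local Notation R := (tate p_pr).
Let T : R := tate_cst p_pr 'X.

Lemma tate_contract_X : tate_contract p_pr T = p%:R * T.
Proof.
rewrite /T /= tate_lift_cst /= comp_polyX -mul_polyC rmorphM polyC_natr.
by rewrite rmorph_nat.
Qed.

(** Up to sign and up to the image of the contraction, the period of the
    extension attached to t^(p^n) is the restriction to the small disc of the
    n-th Frobenius translate F_n of the lacunary series. As F_n does not lie in
    Z_p<t>, this restriction is given by its approximations. *)
Lemma tate_period n (s1 s0 : R) :
  tate_mod s1 = 0 -> tate_mod s0 = 'X^(p ^ n) ->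
  exists w, forall M, pdvd p (p ^ M)
    (lacunary_cocycle p (tate_at0 p_pr s1) (tate_contract p_pr s0)
     - tate_contract p_pr
         (w - \sum_(k < M | lacunary k) T ^+ (p ^ (n + k)))).
Proof.
move=> s10 s0X; set q := (p ^ n)%N.
have q_gt0 : (0 < q)%N by rewrite expn_gt0 prime_gt0.
pose C := @tate_contract p p_pr; pose Z := @tate_at0 p p_pr.
have sep := @tate_separated p p_pr; have cpl := @tate_complete p p_pr.
have near (x y : R) : tate_mod x = tate_mod y -> padic_near p x y.
  move=> xy; apply: padic_near_pdvd; apply/tate_mod_eq0.
  by rewrite rmorphB /= xy; apply: subrr.
have near_s1 : padic_near p s1 0 by apply: near; rewrite s10 rmorph0.
have near_s0 : padic_near p (T ^+ q) s0.
  apply: near; rewrite s0X rmorphXn /= tate_mod_cst /poly_mod_p map_polyX.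
  by [].
have near_T : padic_near p 0 (C (T ^+ q)).
  apply: near; rewrite rmorph0 tate_mod_contract rmorphXn /= tate_mod_cst.
  by rewrite /poly_mod_p map_polyX comp_Xn_poly expr0n eqn0Ngt q_gt0.
have near_Z : padic_near p (Z s1) 0.
  by have := padic_near_morph Z near_s1; rewrite rmorph0.
have near_C := padic_near_morph C near_s0.
(* F(Z s1) - F(C s0), cut at 0 and at C (t^q): the first and last parts are images
   under C, and the middle one is - F(C (t^q)). *)
rewrite (lacunary_cocycle_trans p_pr sep cpl near_Z
  (padic_near_trans p_pr near_T near_C)).
rewrite (lacunary_cocycle_trans p_pr sep cpl near_T near_C).
rewrite -[in lacunary_cocycle p (Z s1) 0](rmorph0 Z) !lacunary_cocycle_morph //.
exists (Z (lacunary_cocycle p s1 0) + lacunary_cocycle p (T ^+ q) s0) => M.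
rewrite rmorphB rmorphD (tate_contract_at0 (lacunary_cocycle p s1 0)).
set x := lacunary_cocycle p 0 _; set y := Z _; set z := C _.
have -> v : y + (x + z) - (y + z - v) = x - - v by ring.
apply: (padic_lim_pdvd (lacunary_cocycle_lim p_pr cpl near_T) (M := M)) => M' MM'.
pose g k := C (T ^+ q) ^+ (p ^ k).
have gE N : lacunary_sum p 0 (C (T ^+ q)) N = - \sum_(k < N | lacunary k) g k.
  rewrite -sumrN; apply: eq_bigr => k _.
  by rewrite expr0n eqn0Ngt expn_gt0 prime_gt0 // sub0r.
have -> : C (\sum_(k < M | lacunary k) T ^+ (p ^ (n + k))) =
    \sum_(k < M | lacunary k) g k.
  by rewrite rmorph_sum; apply: eq_bigr => k _; rewrite expnD exprM rmorphXn.
rewrite gE opprK addrC; move/subnKC: MM' => <-.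
elim: (M' - M)%N => [|j IH]; first by rewrite addn0 subrr; apply: pdvd0.
rewrite addnS [X in _ - X]big_mkcond big_ord_recr -big_mkcond opprD addrA /=.
apply: pdvdB IH _; case: ifP => _; last exact: pdvd0.
rewrite /g rmorphXn /= -exprM tate_contract_X exprMn; apply: pdvdMr.
apply: pdvd_le (pdvd_exp _ _ _).
apply: leq_trans (leq_pexp2l (prime_gt0 p_pr) (leq_addr j M)) _.
by rewrite leq_pmull.
Qed.

End FrobeniusPeriods.

(** Dividing the coefficients by a common power of p makes one of them nonzero
    modulo p. A relation between power series in p t then gives, degree by
    degree, a relation between power series in t, which is reduced modulo p. *)
Lemma tate_periods_independent (p : nat) (p_pr : prime p) (r : nat)
    (a c : 'I_r -> tate p_pr) :
  (forall n : 'I_r, exists w, forall M, pdvd p (p ^ M)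
    (c n - tate_contract p_pr
       (w - \sum_(k < M | lacunary k) (tate_cst p_pr 'X) ^+ (p ^ (n + k))))) ->
  \sum_n tate_contract p_pr (a n) * c n = 0 -> forall n, a n = 0.
Proof.
move=> /choice[w wE] rel n1; apply/eqP/negPn/negP => a0.
have [v [b [bE [n0 /eqP b0]]]] := tate_primitive_part (ex_intro _ n1 a0).
apply: b0; pose C := @tate_contract p p_pr.
have {}rel : \sum_n C (b n) * c n = 0.
  apply: (pdvd_regl (k := v) (@tate_torsion_free p p_pr)).
  rewrite mulr0 -[RHS]rel mulr_sumr; apply: eq_bigr => n _.
  by rewrite bE rmorphM rmorphXn rmorph_nat mulrA.
apply: (@lacunary_independent _ p r (fun n => tate_mod (b n))
  (\sum_n tate_mod (b n) * tate_mod (w n))) => [|M i iM]; first exact: prime_gt1.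
pose G n M : tate p_pr :=
  \sum_(k < M | lacunary k) (tate_cst p_pr 'X) ^+ (p ^ (n + k)).
have GE n : tate_mod (G n M) = lacunary_poly 'F_p p n M.
  rewrite rmorph_sum; apply: eq_bigr => k _.
  by rewrite rmorphXn /= tate_mod_cst /poly_mod_p map_polyX.
have div : pdvd p (p ^ M) (C (\sum_n b n * (w n - G n M))).
  rewrite rmorph_sum -[X in pdvd _ _ X]subr0 -[X in _ - X]rel -sumrB.
  apply: pdvd_sum => n _.
  by rewrite rmorphM -mulrBr; apply/pdvdMl/pdvd_sym/wE.
have := tate_contract_pdvd div iM.
rewrite rmorph_sum coef_sum => E; apply/esym/subr0_eq; rewrite -[RHS]E.
rewrite !coef_sum -sumrB; apply: eq_bigr => n _.
by rewrite rmorphM rmorphB /= GE mulrBr coefB.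
Qed.

Theorem proposition5p8 (p : nat) (p_pr : prime p) :
  exists (M : isocrystal p (A1 p))
         (i : isoc_hom (isoc_unit p (A1 p)) M)
         (q : isoc_hom M (isoc_unit p (A1 p))),
    short_exact i q /\
    forall N : isocrystal p (A1 p),
      F_invariant (pchar_A1 p_pr) N -> ~ subquotient M N.
Proof.
have [s s_lift] : exists s, lifting (p := p) ('X : A1 p) s.
  by exists (fun T => projT1 (cid (epi_surj (estr T 'X)))) => T; case: cid.
exists (lext p_pr s_lift), (lext_incl p_pr s_lift), (lext_proj p_pr s_lift).
split=> [|N NF /(lext_subquotient_orbit NF) orb]; first exact: lext_exact.
have [sn sub] := choice orb.
have sn_lift n : lifting ('X^(p ^ n) : A1 p) (sn n) by case: (sub n).
have {}sub n : subquotient (lext p_pr (sn_lift n)) N.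
  by case: (sub n) => l; rewrite (Prop_irrelevance l (sn_lift n)).
have [f fE] := ehom_contract p_pr; have [h hE] := ehom_at0 p_pr.
have [r [u [[n0 un0] rel]]] := lext_period_relation (D := ehomQ h)
  (@tateQ_domain p p_pr : GRing.integral_domain_axiom (eringQ (tate_line p_pr)))
  (tateQ_at0_factor fE hE) sub.
have [i pi1] := tateQ_p p_pr.
pose c n := lacunary_cocycle p (tate_at0 p_pr (sn n (tate_disc p_pr)))
  (tate_contract p_pr (sn n (tate_line p_pr))).
have [k kE] := choice (fun n => tateQ_frac (u n)); have [a aE] := choice kE.
(* Clearing denominators: p^K u n lies in Z_p<t>, for all n. *)
pose K := (\sum_n k n)%N.
pose b n : tate p_pr := p%:R ^+ (K - k n) * a n.
have bE n : p%:R ^+ K * u n = tateQ_loc (b n).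
  have kK : (k n <= K)%N by rewrite /K (bigD1 n) //= leq_addr.
  rewrite rmorphM rmorphXn rmorph_nat /= -aE mulrA -exprD.
  by rewrite subnK.
have b0 : forall n, b n = 0.
  apply: (@tate_periods_independent p p_pr r b (fun n => c n)) => [n|].
    apply: tate_period.
      rewrite [LHS](sn_lift n (tate_disc p_pr)) /= comp_Xn_poly.
      by rewrite expr0n eqn0Ngt expn_gt0 prime_gt0.
    by rewrite [LHS](sn_lift n (tate_line p_pr)).
  apply: (@tateQ_loc_inj p p_pr).
  have := congr1 (fun y => p%:R ^+ K * y) rel; rewrite mulr0 mulr_sumr => relK.
  rewrite rmorph0 -[RHS]relK rmorph_sum; apply: eq_bigr => n _.
  rewrite rmorphM mulrA.
  have -> : p%:R ^+ K * ehomQ f (u n) = ehomQ f (p%:R ^+ K * u n).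
    by rewrite rmorphM rmorphXn rmorph_nat.
  by rewrite bE (ehomQ_loc f) /lext_period fE hE.
move/eqP: un0; apply; rewrite -[u n0]mul1r.
have <- : (i * p%:R) ^+ K = 1 by rewrite mulrC pi1 expr1n.
by rewrite exprMn -mulrA bE b0 rmorph0 mulr0.
Qed.
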